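(* Let $K$ be a kernel of order $\ell\ge1$ that is a probability density, and let $X_1,X_2,\dots$ be iid real random variables having a Lebesgue density $f$ with distribution function $F$ such that $F\in C^{0,\alpha}$ for some $0<\alpha\le1$. Let $d=d_\infty$ or $d=d_{kuip,k}$ for some $k\in\mathbb{N}$. Let $s:\mathbb{N}\to(0,\infty)$ be a threshold function, i.e. $s(n)\to0$, such that $$\sqrt{\frac{\log\log n}{n}}=o(s(n))\quad\text{and}\quad n^\alpha s(n)\to\infty\qquad(n\to\infty).$$ Let $h_{s,n}>0$ be a bandwidth chosen as a solution $h$ of $d(F_n,\hat F_n^h)=s(n)$. Then with probability $1$, $$\lim_{n\to\infty}\int_{\mathbb{R}}|\hat f_{h_{s,n}}(x)-f(x)|\,dx=0.$$
   Context: Kernel: for $\ell\in\mathbb{N}$, $\ell\ge1$, a function $K:\mathbb{R}\to\mathbb{R}$ is a kernel of order $\ell$ if $u^jK(u)\in L_1(\mathbb{R})$ for $j=0,\dots,\ell$, $\int K(u)\,du=1$, $\int u^jK(u)\,du=0$ for $j=1,\dots,\ell-1$, and $\int u^\ell K(u)\,du=k_\ell\in\mathbb{R}\setminus\{0\}$. $\mathbb{K}(x):=\int_{-\infty}^xK(u)\,du$. Estimators: $F_n$ is the empirical distribution function of $X_1,\dots,X_n$; for $h>0$, the kernel density estimator is $\hat f_h(x):=\frac1{nh}\sum_{i=1}^nK\left(\frac{x-X_i}{h}\right)$ and $\hat F_n^h(x):=\int_{-\infty}^x\hat f_h(t)\,dt=\frac1n\sum_{i=1}^n\mathbb{K}\left(\frac{x-X_i}{h}\right)$.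 Thus $\hat f_{h_{s,n}}$ is based on $X_1,\dots,X_n$ with bandwidth $h_{s,n}$. Distances: $d_\infty(F,G):=\sup_{x\in\mathbb{R}}|F(x)-G(x)|$; for $k\in\mathbb{N}$, $k\ge1$, $$d_{kuip,k}(F,G):=\sup_{a_1\le b_1\le a_2\le b_2\le\dots\le a_k\le b_k}\sum_{i=1}^k|(F(b_i)-F(a_i))-(G(b_i)-G(a_i))|.$$ Hölder class: $C^{0,\alpha}$ is the set of $F:\mathbb{R}\to\mathbb{R}$ for which there is $C>0$ with $|F(x)-F(y)|\le C|x-y|^\alpha$ for all $x,y\in\mathbb{R}$. Chosen bandwidth: $(h_{s,n})$ is an arbitrary sequence of positive random variables (arbitrary data-dependent selection among the solutions if there are several) such that almost surely $d(F_n,\hat F_n^{h_{s,n}})=s(n)$ for all sufficiently large $n$; existence of such solutions is presupposed. *)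

(* Defs.v *)
From HB Require Import structures.
From mathcomp Require Import all_boot all_order all_algebra.
From mathcomp Require Import all_classical all_reals all_analysis.

Set Implicit Arguments.
Unset Strict Implicit.
Unset Printing Implicit Defensive.

Import Order.TTheory GRing.Theory Num.Theory.
Import numFieldNormedType.Exports.

Local Open Scope classical_set_scope.
Local Open Scope ring_scope.

(* Measurability of [K], and of all [u ^+ j * K u], is part of [integrable].
   The existential constant is the [k_l] of the usual definition. *)
Definition kernel_of_order (R : realType) (l : nat) (K : R -> R) : Prop :=
  let mu := @lebesgue_measure R in
  [/\ (1 <= l)%N,
      forall j, (j <= l)%N -> mu.-integrable setT (fun u => (u ^+ j * K u)%:E),
      (\int[mu]_u (K u)%:E = 1)%E,
      forall j, (1 <= j < l)%N -> (\int[mu]_u (u ^+ j * K u)%:E = 0)%E &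
      exists2 kl : R, kl != 0 & (\int[mu]_u (u ^+ l * K u)%:E = kl%:E)%E].

Definition probability_density (R : realType) (f : R -> R) : Prop :=
  [/\ measurable_fun setT f, forall x, 0 <= f x &
      (\int[@lebesgue_measure R]_x (f x)%:E = 1)%E].

Definition has_density (disp : measure_display) (T : measurableType disp)
    (R : realType) (P : probability T R) (X : {RV P >-> R}) (f : R -> R) : Prop :=
  probability_density f /\
  forall A : set R, measurable A ->
    (distribution P X A = \int[@lebesgue_measure R]_(x in A) (f x)%:E)%E.

(* Mutual independence: the product rule over every finite subfamily. *)
Definition independent_RVs (disp : measure_display) (T : measurableType disp)
    (R : realType) (P : probability T R) (X : nat -> {RV P >-> R}) : Prop :=
  forall (J : seq nat) (B : nat -> set R), uniq J ->
    (forall i, i \in J -> measurable (B i)) ->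
    (P (\bigcap_(i in [set` J]) (X i @^-1` B i)) =
     \prod_(i <- J) P (X i @^-1` B i))%E.

Definition iid (disp : measure_display) (T : measurableType disp)
    (R : realType) (P : probability T R) (X : nat -> {RV P >-> R}) : Prop :=
  independent_RVs X /\
  forall (i : nat) (A : set R), measurable A ->
    distribution P (X i) A = distribution P (X 0%N) A.

Definition distribution_function (disp : measure_display)
    (T : measurableType disp) (R : realType) (P : probability T R)
    (X : {RV P >-> R}) : R -> R :=
  fun x => fine (cdf X x).

(* In the estimators [x] is a realized sample, indexed from 0: its first [n]
   observations are [x 0, ..., x n.-1]. *)
Definition empirical_df (R : realType) (n : nat) (x : nat -> R) : R -> R :=
  fun t => n%:R^-1 * \sum_(i < n) (x i <= t)%R%:R.

Definition kde (R : realType) (K : R -> R) (n : nat) (h : R) (x : nat -> R) :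
    R -> R :=
  fun t => (n%:R * h)^-1 * \sum_(i < n) K ((t - x i) / h).

Definition kernel_df (R : realType) (K : R -> R) (n : nat) (h : R)
    (x : nat -> R) : R -> R :=
  fun t => \int[@lebesgue_measure R]_(u in `]-oo, t]) kde K n h x u.

(* The suprema are taken in the extended reals, so that they are meaningful for
   arbitrary functions. *)
Definition d_infty (R : realType) (F G : R -> R) : \bar R :=
  ereal_sup [set `|F x - G x|%:E | x in [set: R]].

Definition kuiper_points (R : realType) (k : nat) (a b : 'I_k -> R) : Prop :=
  (forall i, a i <= b i) /\
  (forall i j : 'I_k, j = i.+1 :> nat -> b i <= a j).

Definition d_kuip (R : realType) (k : nat) (F G : R -> R) : \bar R :=
  ereal_sup [set (\sum_(i < k)
      `|(F (ab.2 i) - F (ab.1 i)) - (G (ab.2 i) - G (ab.1 i))|)%:E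
    | ab in [set ab : ('I_k -> R) * ('I_k -> R) | kuiper_points ab.1 ab.2]].

Definition holder_class (R : realType) (alpha : R) (F : R -> R) : Prop :=
  exists2 C : R, 0 < C & forall x y, `|F x - F y| <= C * `|x - y| `^ alpha.

(* Main.v *)
(** Write mu_n for the empirical measure and K_h u = K (u / h) / h, so that the
    kernel estimator is mu_n * K_h, and let s n be the prescribed distance.

    Local fluctuations of mu_n: by a union bound over the cells of a grid of mesh
    A / n, almost surely no cell carries more than a fraction o(s n) of the sample,
    because the Hoelder condition bounds its probability by O(n^-alpha) = o(s n).  If
    h <= A / n, averaging F_n against K_h therefore moves F_n by o(s n) only; hence
    n * h_n -> oo.

    Spread of K_h: the increment u t = mu_n ]t, t + L] is within O(s n) of u * K_h.
    If h_n >= eta, a discrete maximum principle turns a near-maximal u t into many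
    disjoint intervals of near-maximal mass, so the maximum of u is small; as mu_n is
    tight this fails for large n, and h_n -> 0.

    L1 consistency (Devroye): replace every observation, and the density f, by the
    reference point of its cell in a grid of mesh A / n on [-B, B[.  As n * h_n -> oo,
    continuity of translations in L1 makes this replacement cheap, uniformly in h.
    What remains is the l1 distance of two multinomial frequency vectors with
    2 B n / A cells, which is exponentially unlikely to exceed e once A is large. *)

Require Import Defs.
From HB Require Import structures.
From mathcomp Require Import all_boot all_order all_algebra.
From mathcomp Require Import all_classical all_reals all_analysis.
From mathcomp Require Import measurable_realfun.
From mathcomp Require Import ring lra.

Set Implicit Arguments.
Unset Strict Implicit.
Unset Printing Implicit Defensive.

Import Order.TTheory GRing.Theory Num.Theory.
Import numFieldNormedType.Exports.

Local Open Scope classical_set_scope.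
Local Open Scope ring_scope.

(** * Affine maps and translations in L1 *)

(** The bandwidth may depend on the data, so no probability is ever computed for a random [h].
    Chance enters through cell counts on nonrandom grids, by two Borel-Cantelli arguments
    ([occupancy_eventually] and [freq_dev_eventually]); once these counts are controlled, the
    remaining estimates are deterministic and valid for every [h] in the relevant range.

    The condition n^alpha s n -> oo makes the same number exceed any multiple of n^(1 - alpha), the
    order of the bound on the expected count of a cell.

    Since n h_n -> oo is all that is known of the rate, the mesh must have order 1 / n and the
    number of cells is proportional to n; the choice of [A] keeps it below the exponent of the
    multinomial tail bound. Hence the order of choices: the accuracy e fixes [B], then [A]; the L1
    modulus of continuity of [K] gives [dK]; and then n h_n > A / dK is demanded. *)

Section affine.
Context {R : realType}.
Local Notation mu := (@lebesgue_measure R).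

(** [|a|] times the pushforward of [mu] agrees with [mu] on the intervals []u, v]]; uniqueness of
    Lebesgue measure does the rest. *)
Lemma lebesgue_measure_affine (a b : R) (A : set R) : a != 0 -> measurable A ->
  mu ((fun x => a * x + b) @^-1` A) = (`|a|^-1%:E * mu A)%E.
Proof.
move=> a0 mA.
have mf : measurable_fun setT ((fun x => a * x + b) : measurableTypeR R -> measurableTypeR R).
  by apply: measurable_funD => //; exact: measurable_funM.
have an0 : 0 < `|a| by rewrite normr_gt0.
have H : mu A = (`|a|%:E * mu ((fun x => (a * x + b)%R) @^-1` A))%E.
  have := @lebesgue_measure_unique R (mscale (NngNum (normr_ge0 a))
    (pushforward mu ((fun x => a * x + b) : measurableTypeR R -> measurableTypeR R))).
  move=> /(_ mf)/(_ _ A mA) -> //= _ [[u v]] _ <-.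
  rewrite /mscale/= /pushforward/=.
  have [ap|an] := ltP 0 a.
    rewrite (_ : _ @^-1` _ = `](u - b) / a, (v - b) / a]%classic); last first.
      by apply/seteqP; split => x /=; rewrite !in_itv/= ltr_pdivrMr// ler_pdivlMr// ltrBlDr lerBrDr mulrC.
    rewrite !lebesgue_measure_itv/= !lte_fin ltr_pM2r ?invr_gt0// ltrD2r.
    case: ifP => _; last by rewrite mule0.
    by rewrite -!EFinB -EFinM gtr0_norm//; congr (_%:E); field.
  (* A negative slope turns []u, v]] into an interval closed on the left, of the same length as
     before. *)
  have {}an : a < 0 by rewrite lt_neqAle a0.
  rewrite (_ : _ @^-1` _ = `[(v - b) / a, (u - b) / a[%classic); last first.
    apply/seteqP; split => x /=; rewrite !in_itv/= ltr_ndivlMr// ler_ndivrMr// ltrBlDr lerBrDr mulrC.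
      by rewrite andbC.
    by rewrite andbC.
  rewrite !lebesgue_measure_itv/= !lte_fin ltr_nM2r ?invr_lt0// ltrD2r.
  case: ifP => _; last by rewrite mule0.
  by rewrite -!EFinB -EFinM ltr0_norm//; congr (_%:E); field.
rewrite H muleA -EFinM mulVf ?mul1e// gt_eqF//.
Qed.

Lemma ge0_integral_affine (a b : R) (g : R -> \bar R) : a != 0 ->
  measurable_fun setT g -> (forall x, 0 <= g x)%E ->
  (\int[mu]_x g (a * x + b)%R = `|a|^-1%:E * \int[mu]_x g x)%E.
Proof.
move=> a0 mg g0.
have mf : measurable_fun setT ((fun x => a * x + b) : measurableTypeR R -> measurableTypeR R).
  by apply: measurable_funD => //; exact: measurable_funM.
have := @ge0_integral_pushforward _ _ _ _ R _ mf mu setT g measurableT mg (fun y _ => g0 y).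
rewrite preimage_setT => /= <-.
have ai : 0 <= `|a|^-1 by rewrite invr_ge0.
rewrite -(@ge0_integral_mscale _ _ _ mu setT measurableT (NngNum ai) g)//.
apply: eq_measure_integral => A mA _ /=.
by rewrite /pushforward lebesgue_measure_affine.
Qed.

End affine.


Section L1_translation.
Context {R : realType}.
Local Notation mu := (@lebesgue_measure R).

Lemma measurable_affine (a b : R) : measurable_fun [set: R] (fun x => a * x + b).
Proof. by apply: measurable_funD => //; exact: measurable_funM. Qed.

Lemma integrable_tail (K : R -> R) : mu.-integrable setT (EFin \o K) ->
  forall e, 0 < e -> exists N : nat,
    (\int[mu]_x (if (N%:R <= `|x|)%R then `|K x| else 0)%:E <= e%:E)%E.
Proof.
move=> iK e e0.
have mK : measurable_fun setT K by move/measurable_int: iK => /measurable_EFinP.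
have mif n : measurable_fun setT (fun x : R => (if n%:R <= `|x| then `|K x| else 0)).
  apply: measurable_fun_ifT => //=; last exact: measurableT_comp.
  by apply: measurable_fun_ler => //; exact: normr_measurable.
have H : (\int[mu]_x (if (n%:R <= `|x|)%R then `|K x| else 0)%:E)%E @[n --> \oo]
   --> (\int[mu]_x (cst 0%E x))%E.
  apply: (@dominated_cvg _ _ R mu setT measurableT _ _ (fun x => `|K x|%:E)) => //=.
  - by move=> n; apply/measurable_EFinP; exact: mif.
  - move=> x _; apply: cvg_near_cst.
    near=> n; rewrite ifF//; apply/negbTE; rewrite -ltNge.
    near: n; exact: nbhs_infty_gtr.
  - exact: integrable_abse iK.
  - by move=> n x _; rewrite lee_fin; case: ifP => _; rewrite ?normr_id ?normr0.
rewrite integral_cst // mul0e in H.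
have /fine_cvgP[Hf Hc] := H.
have := Hf; have /cvgrPdist_le/(_ e e0) := Hc => H1 H2.
have [N _ HN] := filterI H1 H2; exists N.
have [/= h1 h2] := HN N (leqnn N).
rewrite -(fineK h2) lee_fin (le_trans (ler_norm _))//.
by rewrite sub0r normrN in h1.
Unshelve. all: by end_near. Qed.

(** By contradiction, a failing sequence of shifts tends to 0 and is bounded by 1. Both functions
    then vanish outside [[- M - 1, M + 1]], where dominated convergence applies with the constant
    [C + C]. *)
Lemma cont_translation (f : R -> R) (M C : R) : 0 <= M -> continuous f ->
  (forall x, `|f x| <= C) -> (forall x, M <= `|x| -> f x = 0) ->
  forall e, 0 < e -> exists2 d, 0 < d & forall t, `|t| <= d ->
    (\int[mu]_x `|f (x + t)%R - f x|%:E <= e%:E)%E.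
Proof.
move=> M0 cf fC f0 e e0; apply: contrapT => /forall2NP H.
have H1 n : exists t : R, `|t| <= n.+1%:R^-1 /\ ~ (\int[mu]_x `|f (x + t)%R - f x|%:E <= e%:E)%E.
  have [h|/existsNP[t /not_implyP[? ?]]] := H n.+1%:R^-1; last by exists t.
  by exfalso; apply: h; rewrite invr_gt0.
have [t Ht] := choice H1.
have mf : measurable_fun setT f by exact: continuous_measurable_fun.
pose D := `[- M - 1, M + 1]%classic : set R.
have mg (s : R) : measurable_fun setT (fun x : R => `|f (x + s) - f x|).
  apply: measurableT_comp => //; apply: measurable_funB => //.
  by apply: measurableT_comp => //; exact: measurable_funD.
have t1 n : `|t n| <= 1.
  have [h _] := Ht n; rewrite (le_trans h)// invf_le1 ?ltr0n//.
  by rewrite ler1n.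
have t0 : t n @[n --> \oo] --> 0.
  apply/cvgr0Pnorm_le => r r0; near=> n.
  have [h _] := Ht n; rewrite (le_trans h)//.
  by rewrite ltW//; near: n; exact: (near_infty_natSinv_lt (PosNum r0)).
have EqD n : (\int[mu]_x `|f (x + t n)%R - f x|%:E = \int[mu]_(x in D) `|f (x + t n)%R - f x|%:E)%E.
  rewrite [RHS]integral_mkcond; apply: eq_integral => x _.
  rewrite patchE; case: ifPn => // /negP; rewrite inE /D /= in_itv/= => /negP xD.
  have xM : M + 1 <= `|x|.
    by move: xD; rewrite negb_and -!ltNge ler_normr => /orP[] h; apply/orP; lra.
  rewrite !f0 ?subrr ?normr0//; first lra.
  have := lerB_normD x (t n); have := t1 n; lra.
have : (\int[mu]_(x in D) `|f (x + t n)%R - f x|%:E)%E @[n --> \oo] --> (\int[mu]_(x in D) (cst 0%E x))%E.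
  apply: (@dominated_cvg _ _ R mu D _ _ _ (fun x => (C + C)%:E)) => //=.
  - exact: measurable_itv.
  - by move=> n; apply/measurable_EFinP; apply: measurable_funTS; exact: (mg (t n)).
  - move=> x _; apply: cvg_EFin; first exact: nearW.
    rewrite [X in _ --> X](_ : 0 = `|f (x + 0) - f x|); last by rewrite addr0 subrr normr0.
    apply: cvg_norm; apply: cvgB; last exact: cvg_cst.
    apply: (continuous_cvg _ (cf (x + 0))).
    by apply: cvgD => //; exact: cvg_cst.
  - apply: (@continuous_compact_integrable _ (cst (C + C))); first exact: segment_compact.
    by apply: continuous_subspaceT => ?; exact: cvg_cst.
  - move=> n x _; rewrite lee_fin normr_id (le_trans (ler_normB _ _))//.
    by rewrite lerD.
rewrite integral0.
move=> /fine_cvgP[Hf /cvgrPdist_le/(_ e e0) Hc].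
have [N _ HN] := filterI Hc Hf.
have [/= h1 h2] := HN N (leqnn N).
have [_ ] := Ht N; apply.
rewrite EqD -(fineK h2) lee_fin (le_trans (ler_norm _))//.
by rewrite sub0r normrN in h1.
Unshelve. all: by end_near. Qed.

(** Density argument: [K] is replaced by a continuous function of compact support, at cost [2 e / 5]
    both before and after the shift; shifting the continuous function costs [e / 5]. *)
Lemma L1_translation (K : R -> R) : mu.-integrable setT (EFin \o K) ->
  forall e, 0 < e -> exists2 d, 0 < d & forall t, `|t| <= d ->
    (\int[mu]_x `|K (x + t)%R - K x|%:E <= e%:E)%E.
Proof.
move=> iK e e0.
have mK : measurable_fun setT K by move/measurable_int: iK => /measurable_EFinP.
have e5 : 0 < e / 5 by rewrite divr_gt0.
have [N HN] := integrable_tail iK e5.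
pose D := `[- (N%:R + 1), N%:R + 1]%classic : set R.
have mD : measurable D by exact: measurable_itv.
have Dfin : (mu D < +oo)%E.
  by rewrite lebesgue_measure_itv/=; case: ifP => _; rewrite ?ltry// -EFinB ltry.
have iKD : mu.-integrable D (EFin \o K) by apply: integrableS iK.
have [g_ [cg ig /fine_cvgP[gf /cvgrPdist_le/(_ _ e5) gc]]] :=
  @approximation_continuous_integrable R D K mD Dfin iKD.
have [n _ Hn] := filterI gc gf.
have [/= h1 h2] := Hn n (leqnn n).
rewrite sub0r normrN in h1.
pose g := g_ n.
(* Trapezoidal cutoff, 1 on [[- N, N]] and 0 outside [[- N - 1, N + 1]]: the approximation [g] is
   controlled on [D] only and has to be cut off there. *)
pose chi (x : R) := Num.max 0 (Num.min 1 (N%:R + 1 - `|x|)).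
have chi0 x : 0 <= chi x by rewrite le_max lexx.
have chi1 x : chi x <= 1 by rewrite ge_max ler01 ge_min lexx.
have chiN x : `|x| <= N%:R -> chi x = 1.
  move=> xN; rewrite /chi (_ : Num.min _ _ = 1); first by rewrite max_r.
  by rewrite min_l//; lra.
have chiE x : N%:R + 1 <= `|x| -> chi x = 0.
  by move=> xN; rewrite /chi max_l// ge_min; apply/orP; right; lra.
pose f x := g x * chi x.
have cf : continuous f.
  move=> x; apply: cvgM; first exact: cg.
  apply: (@continuous_max R R (cst 0) (cst 1 \min (fun x : R => N%:R + 1 - `|x|))); first exact: cvg_cst.
  apply: (@continuous_min R R (cst 1) (fun x : R => N%:R + 1 - `|x|)); first exact: cvg_cst.
  by apply: cvgB; [exact: cvg_cst|exact: norm_continuous].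
have [C fC] : exists C, forall x, `|f x| <= C.
  have [c _ Hc] := @EVT_max R (fun x => `|f x|) (- (N%:R + 1)) (N%:R + 1) ltac:(have := ler0n R N; lra)
    (continuous_subspaceT (fun x => cvg_norm (cf x))).
  exists (`|f c|) => x.
  have [xN|xN] := leP `|x| (N%:R + 1).
    by apply: Hc; rewrite in_itv/= -ler_norml.
  by rewrite /f chiE ?mulr0 ?normr0// ltW.
have [d d0 Hd] := @cont_translation f (N%:R + 1) C ltac:(have := ler0n R N; lra) cf fC
   (fun x xN => etrans (congr1 (fun y => g x * y) (chiE x xN)) (mulr0 _)) _ e5.
have mf : measurable_fun setT f by exact: continuous_measurable_fun.
have Kf : (\int[mu]_x `|K x - f x|%:E <= (e / 5 + e / 5)%:E)%E.
  rewrite EFinD.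
  have E1 : (\int[mu]_x (if x \in D then `|K x - g x| else 0)%:E <= (e/5)%:E)%E.
    rewrite (_ : (\int[mu]_x _)%E = (\int[mu]_(x in D) `|(K x - g x)%:E|)%E); last first.
      by rewrite [RHS]integral_mkcond; apply: eq_integral => x _; rewrite patchE; case: ifP.
    by rewrite -(fineK h2) lee_fin (le_trans (ler_norm _)).
  apply: (le_trans _ (leeD E1 HN)).
  have m1 : measurable_fun setT (fun x : R => (if x \in D then `|K x - g x| else 0)).
    apply: measurable_fun_ifT => //=; last first.
      apply: measurableT_comp => //; apply: measurable_funB => //.
      exact: (continuous_measurable_fun (cg n)).
    apply: (@measurable_fun_bool _ _ _ _ true); rewrite setTI.
    suff -> : (fun x : R => x \in D) @^-1` [set true] = D by [].
    by apply/seteqP; split => x; rewrite /preimage/=; [move=> /set_mem|move=> /mem_set].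
  have m2 : measurable_fun setT (fun x : R => (if N%:R <= `|x| then `|K x| else 0)).
    apply: measurable_fun_ifT => //=; last exact: measurableT_comp.
    by apply: measurable_fun_ler => //; exact: normr_measurable.
  rewrite -ge0_integralD//; last 4 first.
  - by move=> x _; rewrite lee_fin; case: ifP.
  - exact/measurable_EFinP.
  - by move=> x _; rewrite lee_fin; case: ifP.
  - exact/measurable_EFinP.
  apply: ge0_le_integral => //.
  - by apply/measurable_EFinP; apply: measurableT_comp => //; exact: measurable_funB.
  - by apply/measurable_EFinP; apply: measurable_funD.
  move=> x _; rewrite -EFinD lee_fin.
  (* The first term lives on [D], where [g] is close to [K]; the second one lives on the tail. *)
  have KE : K x - f x = chi x * (K x - g x) + (1 - chi x) * K x by rewrite /f; ring.
  rewrite KE (le_trans (ler_normD _ _))// lerD//.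
    case: ifPn => [_|/negP]; first by rewrite normrM ger0_norm// ler_piMl.
    rewrite inE /D/= in_itv/= -ler_norml => /negP; rewrite -ltNge => /ltW xN.
    by rewrite chiE// mul0r normr0.
  case: ifPn => [_|]; first by rewrite normrM ger0_norm ?subr_ge0// ler_piMl// gerBl.
  by rewrite -ltNge => /ltW xN; rewrite chiN// subrr mul0r normr0.
exists d => // t td.
have Kft : (\int[mu]_x `|K (x + t)%R - f (x + t)%R|%:E <= (e / 5 + e / 5)%:E)%E.
  have mKf : measurable_fun setT (fun x : R => `|K x - f x|%:E).
    by apply/measurable_EFinP; apply: measurableT_comp => //; exact: measurable_funB.
  have E := @ge0_integral_affine R 1 t _ (oner_neq0 _) mKf (fun x => normr_ge0 (K x - f x)).
  rewrite normr1 invr1 mul1e in E.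
  apply: le_trans Kf; rewrite -E le_eqVlt; apply/orP; left; apply/eqP.
  by apply: eq_integral => x _; rewrite mul1r.
have mKt : measurable_fun setT (fun x : R => K (x + t)).
  by apply: measurableT_comp => //; exact: measurable_funD.
have mft : measurable_fun setT (fun x : R => f (x + t)).
  by apply: measurableT_comp => //; exact: measurable_funD.
have := leeD (leeD Kft (Hd t td)) Kf.
rewrite -!EFinD (_ : e / 5 + e / 5 + e / 5 + (e / 5 + e / 5) = e); last lra.
apply: le_trans.
rewrite -ge0_integralD//; last 2 first.
- by apply/measurable_EFinP; apply: measurableT_comp => //; exact: measurable_funB.
- by apply/measurable_EFinP; apply: measurableT_comp => //; exact: measurable_funB.
rewrite -ge0_integralD//; last 3 first.
- by move=> x _; rewrite adde_ge0// lee_fin.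
- by apply: emeasurable_funD; apply/measurable_EFinP; apply: measurableT_comp => //; exact: measurable_funB.
- by apply/measurable_EFinP; apply: measurableT_comp => //; exact: measurable_funB.
apply: ge0_le_integral => //=.
- by apply/measurable_EFinP; apply: measurableT_comp => //; exact: measurable_funB.
- apply: emeasurable_funD; first apply: emeasurable_funD.
  + by apply/measurable_EFinP; apply: measurableT_comp => //; exact: measurable_funB.
  + by apply/measurable_EFinP; apply: measurableT_comp => //; exact: measurable_funB.
  + by apply/measurable_EFinP; apply: measurableT_comp => //; exact: measurable_funB.
move=> x _; rewrite lee_fin.
rewrite (_ : K (x + t) - K x = (K (x + t) - f (x + t)) + (f (x + t) - f x) - (K x - f x)); last ring.
by rewrite (le_trans (ler_normB _ _))// lerD2r ler_normD.
Qed.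

End L1_translation.

(** * Discretizing the kernel estimator *)

Section kde_L1.
Context {R : realType}.
Local Notation mu := (@lebesgue_measure R).

(** Read as [A <= B + ...] with nonnegative integrands, so that the integrability of a difference
    never has to be discussed. *)
Lemma abs_sub_integral (a b : R -> R) (A B : R) :
  measurable_fun setT a -> measurable_fun setT b -> (forall y, 0 <= a y) -> (forall y, 0 <= b y) ->
  (\int[mu]_y (a y)%:E = A%:E)%E -> (\int[mu]_y (b y)%:E = B%:E)%E ->
  (`|A - B|%:E <= \int[mu]_y `|a y - b y|%:E)%E.
Proof.
have key (u v : R -> R) (U V : R) :
    measurable_fun setT u -> measurable_fun setT v -> (forall y, 0 <= u y) -> (forall y, 0 <= v y) ->
    (\int[mu]_y (u y)%:E = U%:E)%E -> (\int[mu]_y (v y)%:E = V%:E)%E ->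
    ((U - V)%:E <= \int[mu]_y `|u y - v y|%:E)%E.
  move=> ma mb a0 b0 HA HB; rewrite EFinB leeBlDr// -HA -HB -ge0_integralD//; last 3 first.
  - by apply/measurable_EFinP; apply: measurableT_comp => //; exact: measurable_funB.
  - by move=> y _; rewrite lee_fin.
  - by apply/measurable_EFinP.
  apply: ge0_le_integral => //.
  - by move=> y _; rewrite lee_fin.
  - by apply/measurable_EFinP.
  - apply/measurable_EFinP; apply: measurable_funD => //.
    by apply: measurableT_comp => //; exact: measurable_funB.
  - by move=> y _; rewrite -EFinD lee_fin -lerBlDr ler_norm.
move=> ma mb a0 b0 HA HB; have [h|h] := leP 0 (A - B).
  by rewrite ger0_norm//; exact: key.
rewrite ltr0_norm// opprB; under eq_integral do rewrite distrC.
exact: key.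
Qed.

Lemma integral_density_shift (k : R -> R) (s : R) : probability_density k ->
  (\int[mu]_t (k (t - s))%:E = 1)%E.
Proof.
move=> [mk k0 k1].
have := @ge0_integral_affine R 1 (- s) (fun x => (k x)%:E) (oner_neq0 _).
rewrite normr1 invr1 mul1e k1 => <-.
- by under [RHS]eq_integral do rewrite mul1r.
- exact/measurable_EFinP.
- by move=> x; rewrite lee_fin.
Qed.

Lemma integral_density_reflect (k : R -> R) (s : R) : probability_density k ->
  (\int[mu]_t (k (s - t))%:E = 1)%E.
Proof.
move=> [mk k0 k1].
have := @ge0_integral_affine R (-1) s (fun x => (k x)%:E).
rewrite normrN1 invr1 mul1e k1 => <-.
- by under [RHS]eq_integral do rewrite mulN1r addrC.
- by rewrite oppr_eq0 oner_eq0.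
- exact/measurable_EFinP.
- by move=> x; rewrite lee_fin.
Qed.

Variables (k f : R -> R).
Hypotheses (kd : probability_density k) (fd : probability_density f).

Let mk : measurable_fun setT k. Proof. by case: kd. Qed.
Let mf : measurable_fun setT f. Proof. by case: fd. Qed.
Let k0 x : 0 <= k x. Proof. by case: kd. Qed.
Let f0 x : 0 <= f x. Proof. by case: fd. Qed.
Let f1 : (\int[mu]_x (f x)%:E = 1)%E. Proof. by case: fd. Qed.

Variables (I : finType) (c : R -> I) (r : I -> R).
Hypothesis mc : forall j, measurable (c @^-1` [set j]).
Variable p : I -> R.
Hypothesis pE : forall j, (\int[mu]_(y in c @^-1` [set j]) (f y)%:E = (p j)%:E)%E.

Let sum_indicE (g : I -> R) y : g (c y) = \sum_j g j * (c y == j)%:R.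
Proof.
rewrite (bigD1 (c y))//= eqxx mulr1 big1 ?addr0// => j.
by rewrite eq_sym => /negbTE ->; rewrite mulr0.
Qed.

Let mind j : measurable_fun setT (fun y : R => (c y == j)%:R : R).
Proof.
rewrite (_ : (fun y : R => _) = \1_(c @^-1` [set j])); first exact: measurable_indic.
apply/funext => y; rewrite indicE; congr (nat_of_bool _)%:R.
by apply/eqP/idP => [/mem_set//|/set_mem].
Qed.

Let measurable_cell (g : I -> R) : measurable_fun setT (g \o c).
Proof.
rewrite (_ : g \o c = (fun y => \sum_j g j * (c y == j)%:R)); last exact/funext/sum_indicE.
by apply: measurable_sum => j; apply: measurable_funM => //; exact: mind.
Qed.

(** Turns discretized sums against the cell probabilities into integrals against [f], where they can
    be compared with other integrals. *)
Lemma integral_cell (g : I -> R) : (forall j, 0 <= g j) ->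
  (\int[mu]_y (f y * g (c y))%:E = (\sum_j p j * g j)%:E)%E.
Proof.
move=> g0.
transitivity (\int[mu]_y (\sum_j (g j)%:E * (f y * (c y == j)%:R)%:E))%E.
  apply: eq_integral => y _; under eq_bigr do rewrite -EFinM.
  rewrite sumEFin; congr EFin; rewrite sum_indicE mulr_sumr.
  by apply: eq_bigr => j _; rewrite mulrCA.
have mfj j : measurable_fun setT (fun y : R => (f y * (c y == j)%:R)%:E).
  by apply/measurable_EFinP; apply: measurable_funM => //; exact: mind.
rewrite ge0_integral_sum//; last 2 first.
- by move=> j; apply: emeasurable_funM => //; exact: mfj.
- by move=> j y _; rewrite -EFinM lee_fin !mulr_ge0.
rewrite -sumEFin; apply: eq_bigr => j _.
rewrite ge0_integralZl_EFin//; last 2 first.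
- by move=> y _; rewrite lee_fin mulr_ge0.
- exact: mfj.
rewrite mulrC EFinM -pE [in RHS]integral_mkcond; congr (_ * _)%E.
apply: eq_integral => y _; rewrite patchE; case: ifPn => [/set_mem/= ->|].
  by rewrite eqxx mulr1.
case: eqP => [<- /negP[]|_ _]; [exact/mem_set|by rewrite mulr0].
Qed.

(** Triangle inequality through four errors: the observations are moved to the reference points
    ([T1]), the frequencies [m] are replaced by the probabilities [p] ([T2], where each translate of
    [k] has integral 1), the mass of [f] is moved back from the reference points ([q1]), and [f] is
    compared with its smoothing by [k] ([q2]). [g j] bounds the cost of moving a point of cell [j],
    [Rh] the smoothing error. *)
Lemma kde_L1_bound (n : nat) (x : nat -> R) (m g : I -> R) (Rh : \bar R) : (0 < n)%N ->
  (forall j, m j = n%:R^-1 * \sum_(i < n) (c (x i) == j)%:R) ->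
  (forall y, \int[mu]_t `|k (t - r (c y)) - k (t - y)|%:E <= (g (c y))%:E)%E ->
  (\int[mu]_t (\int[mu]_y (`|f t - f y| * k (t - y))%:E) <= Rh)%E -> 
  (forall j, 0 <= g j) ->
  (\int[mu]_t `|n%:R^-1 * (\sum_(i < n) k (t - x i)) - f t|%:E <=
   (\sum_j m j * g j + \sum_j `|m j - p j| + \sum_j p j * g j)%:E + Rh)%E.
Proof.
move=> n0 mE gE RhE g0.
have n0' : 0 <= n%:R^-1 :> R by rewrite invr_ge0.
have mks (s : R) : measurable_fun setT (fun t : R => k (t - s)).
  by apply: measurableT_comp => //; exact: measurable_funB.
have mkr (t : R) : measurable_fun setT (fun y : R => k (t - y)).
  by apply: measurableT_comp => //; exact: measurable_funB.
have mkc (t : R) : measurable_fun setT (fun y : R => k (t - r (c y))).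
  by apply: measurableT_comp => //; apply: measurable_funB => //; exact: (measurable_cell r).
have Em (G : I -> R) : n%:R^-1 * (\sum_(i < n) G (c (x i))) = \sum_j m j * G j.
  under eq_bigr do rewrite sum_indicE.
  rewrite exchange_big/= mulr_sumr; apply: eq_bigr => j _.
  by rewrite -mulr_sumr mE mulrCA [RHS]mulrC.
pose T1 t := n%:R^-1 * (\sum_(i < n) `|k (t - r (c (x i))) - k (t - x i)|).
pose T2 t := \sum_j `|m j - p j| * k (t - r j).
pose q1 (z : R * R) := f z.2 * `|k (z.1 - r (c z.2)) - k (z.1 - z.2)|.
pose q2 (z : R * R) := `|f z.1 - f z.2| * k (z.1 - z.2).
have T10 t : 0 <= T1 t by rewrite mulr_ge0// sumr_ge0.
have T20 t : 0 <= T2 t by rewrite sumr_ge0// => j _; rewrite mulr_ge0.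
have q10 z : 0 <= q1 z by rewrite mulr_ge0.
have q20 z : 0 <= q2 z by rewrite mulr_ge0.
have mT1 : measurable_fun setT T1.
  apply: measurable_funM => //; apply: measurable_sum => i.
  by apply: measurableT_comp => //; exact: measurable_funB.
have mT2 : measurable_fun setT T2.
  by apply: measurable_sum => j; apply: measurable_funM.
have mkz : measurable_fun setT (fun z : R * R => k (z.1 - z.2)).
  by apply: measurableT_comp => //; apply: measurable_funB; [exact: measurable_fst|exact: measurable_snd].
have mq1 : measurable_fun setT q1.
  apply: measurable_funM; first exact: (measurableT_comp mf measurable_snd).
  apply: measurableT_comp => //; apply: measurable_funB => //.
  apply: measurableT_comp => //; apply: measurable_funB; first exact: measurable_fst.
  exact: (measurableT_comp (measurable_cell r) measurable_snd).
have mq2 : measurable_fun setT q2.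
  apply: measurable_funM => //; apply: measurableT_comp => //.
  apply: measurable_funB; first exact: (measurableT_comp mf measurable_fst).
  exact: (measurableT_comp mf measurable_snd).
have mpair (t : R) : measurable_fun setT (fun y : R => (t, y)).
  by apply: measurable_fun_pair => //; exact: measurable_cst.
have mq1t (t : R) : measurable_fun setT (fun y : R => q1 (t, y)).
  exact: (measurableT_comp mq1 (mpair t)).
have mq2t (t : R) : measurable_fun setT (fun y : R => q2 (t, y)).
  exact: (measurableT_comp mq2 (mpair t)).
have mI1 : measurable_fun setT (fun t => \int[mu]_y (q1 (t, y))%:E)%E.
  by have := @measurable_fun_fubini_tonelli_F _ _ _ _ R mu (EFin \o q1); apply => //; exact/measurable_EFinP.
have mI2 : measurable_fun setT (fun t => \int[mu]_y (q2 (t, y))%:E)%E.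
  by have := @measurable_fun_fubini_tonelli_F _ _ _ _ R mu (EFin \o q2); apply => //; exact/measurable_EFinP.
have pw t : (`|n%:R^-1 * (\sum_(i < n) k (t - x i)) - f t|%:E <=
    (T1 t)%:E + (T2 t)%:E + (\int[mu]_y (q1 (t, y))%:E + \int[mu]_y (q2 (t, y))%:E))%E.
  have A1 : `|n%:R^-1 * (\sum_(i < n) k (t - x i)) - \sum_j m j * k (t - r j)| <= T1 t.
    rewrite -(Em (fun j => k (t - r j))) -mulrBr -sumrB normrM ger0_norm//.
    rewrite ler_wpM2l// (le_trans (ler_norm_sum _ _ _))// ler_sum// => i _.
    by rewrite distrC.
  have A2 : `|\sum_j m j * k (t - r j) - \sum_j p j * k (t - r j)| <= T2 t.
    rewrite -sumrB (le_trans (ler_norm_sum _ _ _))// ler_sum// => j _.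
    by rewrite -mulrBl normrM [`|k _|]ger0_norm.
  (* Both terms become integrals over [y]: the sum by [integral_cell], and [f t] because [k (t - y)]
     integrates to 1 in [y]. *)
  have A3 : (`|\sum_j p j * k (t - r j) - f t|%:E <=
      \int[mu]_y (q1 (t, y))%:E + \int[mu]_y (q2 (t, y))%:E)%E.
    apply: (le_trans (@abs_sub_integral (fun y => f y * k (t - r (c y)))
      (fun y => f t * k (t - y)) _ _ _ _ _ _ _ _)) => //.
    - exact: measurable_funM.
    - exact: measurable_funM.
    - by move=> y; rewrite mulr_ge0.
    - by move=> y; rewrite mulr_ge0.
    - exact: (integral_cell (fun j => k0 (t - r j))).
    - under eq_integral do rewrite EFinM.
      rewrite ge0_integralZl_EFin//; last 2 first.
      + by move=> y _; rewrite lee_fin.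
      + by apply/measurable_EFinP; exact: mkr.
      by rewrite integral_density_reflect// mule1.
    rewrite -ge0_integralD//; last 4 first.
    - by move=> y _; rewrite lee_fin.
    - by apply/measurable_EFinP; exact: mq1t.
    - by move=> y _; rewrite lee_fin.
    - by apply/measurable_EFinP; exact: mq2t.
    apply: ge0_le_integral => //.
    - apply/measurable_EFinP; apply: measurableT_comp => //; apply: measurable_funB.
        exact: (measurable_funM mf (mkc t)).
      exact: (measurable_funM (measurable_cst _) (mkr t)).
    - by apply: emeasurable_funD; apply/measurable_EFinP; [exact: mq1t|exact: mq2t].
    move=> y _; rewrite -EFinD lee_fin /q1 /q2/=.
    rewrite [X in `|X| <= _](_ : _ =
      f y * (k (t - r (c y)) - k (t - y)) - (f t - f y) * k (t - y)); last ring.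
    rewrite (le_trans (ler_normB _ _))// !normrM (ger0_norm (f0 y)) (ger0_norm (k0 _)).
    by [].
  have A12 : (`|n%:R^-1 * (\sum_(i < n) k (t - x i)) - f t|%:E <=
      (T1 t)%:E + (T2 t)%:E + `|\sum_j p j * k (t - r j) - f t|%:E)%E.
    rewrite -!EFinD lee_fin; move: A1 A2.
    set a := n%:R^-1 * _; set b := \sum_j _; set d := \sum_j _ => A1 A2.
    rewrite (_ : a - f t = (a - b) + (b - d) + (d - f t)); last ring.
    by rewrite (le_trans (ler_normD _ _))// lerD2r (le_trans (ler_normD _ _))// lerD.
  by apply: (le_trans A12); apply: leeD.
apply: (@le_trans _ _ (\int[mu]_t ((T1 t)%:E + (T2 t)%:E +
  (\int[mu]_y (q1 (t, y))%:E + \int[mu]_y (q2 (t, y))%:E)))%E).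
  apply: ge0_le_integral => //.
  - apply/measurable_EFinP; apply: measurableT_comp => //; apply: measurable_funB => //.
    by apply: measurable_funM => //; apply: measurable_sum => i; exact: mks.
  - by apply: emeasurable_funD; apply: emeasurable_funD => //; apply/measurable_EFinP.
have i10 t : (0 <= \int[mu]_y (q1 (t, y))%:E)%E by apply: integral_ge0 => y _; rewrite lee_fin.
have i20 t : (0 <= \int[mu]_y (q2 (t, y))%:E)%E by apply: integral_ge0 => y _; rewrite lee_fin.
rewrite ge0_integralD//; last 4 first.
- by move=> t _; rewrite adde_ge0// lee_fin.
- by apply: emeasurable_funD => //; apply/measurable_EFinP.
- by move=> t _; rewrite adde_ge0.
- exact: emeasurable_funD.
rewrite ge0_integralD//; last 4 first.
- by move=> t _; rewrite lee_fin.
- by apply/measurable_EFinP.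
- by move=> t _; rewrite lee_fin.
- by apply/measurable_EFinP.
have RhE' : (\int[mu]_t (\int[mu]_y (q2 (t, y))%:E) <= Rh)%E by exact: RhE.
rewrite ge0_integralD// !EFinD addeA; apply: leeD; last exact: RhE'.
apply: leeD; first apply: leeD.
- rewrite -(Em g) /T1; under eq_integral do rewrite EFinM -sumEFin.
  rewrite ge0_integralZl_EFin//; last 2 first.
  + by move=> t _; apply: sume_ge0 => i _; rewrite lee_fin.
  + apply: emeasurable_sum => i; apply/measurable_EFinP.
    by apply: measurableT_comp => //; apply: measurable_funB; exact: mks.
  rewrite EFinM lee_pmul2l//; last by rewrite lte_fin invr_gt0 ltr0n.
  rewrite ge0_integral_sum//; last first.
    by move=> i; apply/measurable_EFinP; apply: measurableT_comp => //; apply: measurable_funB; exact: mks.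
  by rewrite -sumEFin lee_sum.
- rewrite /T2; under eq_integral do rewrite -sumEFin.
  rewrite ge0_integral_sum//; last 2 first.
  + by move=> j; apply/measurable_EFinP; apply: measurable_funM => //; exact: mks.
  + by move=> j t _; rewrite lee_fin mulr_ge0.
  rewrite -sumEFin lee_sum// => j _; under eq_integral do rewrite EFinM.
  rewrite ge0_integralZl_EFin//; last 2 first.
  + by move=> t _; rewrite lee_fin.
  + by apply/measurable_EFinP; exact: mks.
  by rewrite integral_density_shift// mule1.
(* With [t] integrated first, the cost for a fixed [y] is at most [g (c y)]. *)
rewrite (@fubini_tonelli _ _ _ _ R mu mu (EFin \o q1))//; last exact/measurable_EFinP.
rewrite -(integral_cell g0).
have mq1y (y : R) : measurable_fun setT (fun t : R => `|k (t - r (c y)) - k (t - y)|).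
  by apply: measurableT_comp => //; exact: measurable_funB.
apply: ge0_le_integral => //.
- by move=> y _; apply: integral_ge0 => t _; rewrite lee_fin.
- by apply: (@measurable_fun_fubini_tonelli_G _ _ _ _ R mu (EFin \o q1)) => //; exact/measurable_EFinP.
- by apply/measurable_EFinP; apply: measurable_funM => //; exact: (measurable_cell g).
move=> y _; under eq_integral do rewrite /q1/= EFinM.
rewrite ge0_integralZl_EFin//; last by apply/measurable_EFinP; exact: mq1y.
by rewrite EFinM lee_wpmul2l// lee_fin.
Qed.

End kde_L1.

(** * Rescaled kernels and the smoothing error *)

Section rescaling.
Context {R : realType}.
Local Notation mu := (@lebesgue_measure R).

Lemma density_integrable (K : R -> R) : probability_density K -> mu.-integrable setT (EFin \o K).
Proof.
move=> [mK K0 K1]; apply/integrableP; split; first exact/measurable_EFinP.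
by under eq_integral do rewrite /= ger0_norm//; rewrite K1 ltry.
Qed.

Definition rescale (K : R -> R) (h : R) : R -> R := fun z => h^-1 * K (z / h).

Lemma rescale_density (K : R -> R) (h : R) : 0 < h ->
  probability_density K -> probability_density (rescale K h).
Proof.
move=> h0 [mK K0 K1]; split.
- apply: measurable_funM; first exact: measurable_cst.
  by apply: measurableT_comp => //; exact: measurable_funM.
- by move=> z; rewrite mulr_ge0// invr_ge0 ltW.
have mKh : measurable_fun setT (fun z : R => (K (z / h))%:E).
  apply/measurable_EFinP; apply: measurableT_comp => //; exact: measurable_funM.
rewrite /rescale; under eq_integral do rewrite EFinM.
rewrite ge0_integralZl_EFin//; last 2 first.
- by move=> z _; rewrite lee_fin.
- by rewrite invr_ge0 ltW.
have := @ge0_integral_affine R h^-1 0 (fun z => (K z)%:E).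
rewrite K1 mule1 ger0_norm ?invr_ge0 ?ltW// invrK => E.
rewrite (_ : (\int[mu]_z _)%E = h%:E); first by rewrite -EFinM mulVf// gt_eqF.
rewrite -E.
- by apply: eq_integral => z _; rewrite addr0 mulrC.
- by rewrite invr_eq0 gt_eqF.
- exact/measurable_EFinP.
- by move=> z; rewrite lee_fin.
Qed.

Lemma kde_rescale (K : R -> R) n h (x : nat -> R) t :
  kde K n h x t = n%:R^-1 * \sum_(i < n) rescale K h (t - x i).
Proof. by rewrite /kde /rescale -mulr_sumr invfM mulrA. Qed.

(** Substituting [z = (t - y) / h] shows that the cost depends on the ratio of the displacement to
    the bandwidth; a mesh of order [1 / n] is therefore fine when [n * h] is large. *)
Lemma rescale_translation (K : R -> R) (h y r : R) : 0 < h -> measurable_fun setT K ->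
  (\int[mu]_t `|rescale K h (t - r) - rescale K h (t - y)|%:E =
   \int[mu]_z `|K (z + (y - r) / h)%R - K z|%:E)%E.
Proof.
move=> h0 mK.
have hn : h != 0 by rewrite gt_eqF.
have mg : measurable_fun setT (fun z : R => `|K (z + (y - r) / h) - K z|%:E).
  apply/measurable_EFinP; apply: measurableT_comp => //; apply: measurable_funB => //.
  by apply: measurableT_comp => //; exact: measurable_funD.
have := @ge0_integral_affine R h^-1 (- (y / h)) _ _ mg (fun z => normr_ge0 (K (z + (y - r) / h) - K z)).
rewrite invr_eq0 => /(_ hn); rewrite ger0_norm ?invr_ge0 ?ltW// invrK => E.
have -> : (\int[mu]_z `|K (z + (y - r) / h)%R - K z|%:E =
    h^-1%:E * (h%:E * \int[mu]_z `|K (z + (y - r) / h)%R - K z|%:E))%E.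
  by rewrite muleA -EFinM mulVf// mul1e.
rewrite -E -ge0_integralZl_EFin//; last 2 first.
- exact: (measurableT_comp mg (measurable_affine h^-1 (- (y / h)))).
- by rewrite invr_ge0 ltW.
apply: eq_integral => t _; rewrite -EFinM; congr EFin.
rewrite /rescale -mulrBr normrM ger0_norm ?invr_ge0 ?ltW//; congr (_ * `|K _ - K _|); field.
all: by [].
Qed.

(** After [y = t - h u] the integral is the [K]-average over [u] of the L1 distance between [f] and
    its shift by [h u]. This distance is small for [|u| < N] by [L1_translation], and at most 2 on
    the tail, where [K] has little mass. *)
Lemma approximate_identity (K f : R -> R) : probability_density K -> probability_density f ->
  forall e, 0 < e -> exists2 eta, 0 < eta & forall h, 0 < h -> h <= eta ->
  (\int[mu]_t (\int[mu]_y (`|f t - f y| * rescale K h (t - y))%:E) <= e%:E)%E.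
Proof.
move=> Kd fd e e0; have [mK K0 K1] := Kd; have [mf f0 f1] := fd.
have e3 : 0 < e / 3 by rewrite divr_gt0.
have [d d0 Hd] := L1_translation (density_integrable fd) e3.
have [N HN] := integrable_tail (density_integrable Kd) e3.
(* For [|u| < N] and [h] up to this witness, [h |u| <= d]; the successor avoids a division by 0. *)
exists (d / N.+1%:R); first by rewrite divr_gt0.
move=> h h0 hd.
have hn : h != 0 by rewrite gt_eqF.
pose w (z : R * R) := `|f (z.1 - h * z.2) - f z.1| * K z.2.
have w0 z : 0 <= w z by rewrite mulr_ge0.
have mw : measurable_fun setT w.
  apply: measurable_funM; last exact: (measurableT_comp mK measurable_snd).
  apply: measurableT_comp => //; apply: measurable_funB; last exact: (measurableT_comp mf measurable_fst).
  apply: measurableT_comp => //; apply: measurable_funB; first exact: measurable_fst.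
  by apply: measurable_funM => //; exact: measurable_snd.
have mpair (t : R) : measurable_fun setT (fun y : R => (t, y)).
  by apply: measurable_fun_pair => //; exact: measurable_cst.
have mwt (t : R) : measurable_fun setT (fun y : R => w (t, y)) by exact: (measurableT_comp mw (mpair t)).
have E1 t : (\int[mu]_y (`|f t - f y| * rescale K h (t - y))%:E = \int[mu]_u (w (t, u))%:E)%E.
  have := @ge0_integral_affine R (- h^-1) (t / h) (fun u => (w (t, u))%:E).
  rewrite oppr_eq0 invr_eq0 => /(_ hn); rewrite normrN ger0_norm ?invr_ge0 ?ltW// invrK.
  move=> H; rewrite -[RHS]mul1e -(mulVf hn) EFinM -muleA -H; last 2 first.
  - by apply/measurable_EFinP; exact: mwt.
  - by move=> u; rewrite lee_fin.
  rewrite -ge0_integralZl_EFin//; last 3 first.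
  - by move=> u _; rewrite lee_fin.
  - have mwE : measurable_fun setT (fun u : R => (w (t, u))%:E) by apply/measurable_EFinP; exact: mwt.
    exact: (measurableT_comp mwE (measurable_affine (- h^-1) (t / h))).
  - by rewrite invr_ge0 ltW.
  apply: eq_integral => y _; rewrite -EFinM; congr EFin.
  rewrite /w /rescale/= (_ : t - h * (- h^-1 * y + t / h) = y); last by field.
  have -> : - h^-1 * y + t / h = (t - y) / h by rewrite mulrBl mulNr addrC [_^-1 * y]mulrC.
  by rewrite [`|f y - f t|]distrC mulrCA.
under eq_integral do rewrite E1.
rewrite (@fubini_tonelli _ _ _ _ R mu mu (EFin \o w))//; last exact/measurable_EFinP.
have om (u : R) : (\int[mu]_t (w (t, u))%:E = (K u)%:E * \int[mu]_t `|f (t - h * u)%R - f t|%:E)%E.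
  rewrite -ge0_integralZl_EFin//.
    by apply: eq_integral => t _; rewrite -EFinM /w mulrC.
  apply/measurable_EFinP; apply: measurableT_comp => //; apply: measurable_funB => //.
  by apply: measurableT_comp => //; exact: measurable_funB.
have om2 (u : R) : (\int[mu]_t `|f (t - h * u)%R - f t|%:E <= 2%:E)%E.
  apply: (@le_trans _ _ (\int[mu]_t ((f (t - h * u))%:E + (f t)%:E))%E).
    apply: ge0_le_integral => //.
    - apply/measurable_EFinP; apply: measurableT_comp => //; apply: measurable_funB => //.
      by apply: measurableT_comp => //; exact: measurable_funB.
    - apply: emeasurable_funD; apply/measurable_EFinP => //.
      by apply: measurableT_comp => //; exact: measurable_funB.
    move=> t _; rewrite -EFinD lee_fin (le_trans (ler_normB _ _))//.
    by rewrite !ger0_norm.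
  rewrite ge0_integralD//; last 4 first.
  - by move=> t _; rewrite lee_fin.
  - by apply/measurable_EFinP; apply: measurableT_comp => //; exact: measurable_funB.
  - by move=> t _; rewrite lee_fin.
  - exact/measurable_EFinP.
  by rewrite integral_density_shift// f1 -EFinD.
have mtail : measurable_fun setT (fun x : R => if N%:R <= `|x| then `|K x| else 0).
  apply: measurable_fun_ifT => //=; last exact: measurableT_comp.
  by apply: measurable_fun_ler => //; exact: normr_measurable.
apply: (@le_trans _ _ (\int[mu]_u ((e / 3)%:E * (K u)%:E +
  2%:E * (if (N%:R <= `|u|)%R then `|K u| else 0)%:E))%E).
  apply: ge0_le_integral => //.
  - by move=> u _; apply: integral_ge0 => t _; rewrite lee_fin.
  - apply: (@measurable_fun_fubini_tonelli_G _ _ _ _ R mu (EFin \o w)) => //; exact/measurable_EFinP.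
  - apply: emeasurable_funD; apply: emeasurable_funM => //; exact/measurable_EFinP.
  move=> u _; rewrite /= om; case: ifPn => uN.
    rewrite (@le_trans _ _ ((K u)%:E * 2%:E)%E)//; first by rewrite lee_wpmul2l// lee_fin.
    by rewrite ger0_norm// [X in (_ <= _ + X)%E]muleC leeDr// -EFinM lee_fin mulr_ge0// ltW.
  rewrite mule0 adde0 muleC lee_wpmul2r ?lee_fin//.
  apply: Hd; rewrite normrN normrM gtr0_norm//.
  move: uN; rewrite -ltNge => uN.
  apply: (@le_trans _ _ (d / N.+1%:R * N%:R)); first by rewrite ler_pM// ltW.
  by rewrite mulrAC ler_pdivrMr// ler_wpM2l ?ler_nat// ltW.
have e30 : 0 <= e / 3 by rewrite ltW.
rewrite ge0_integralD//; last 4 first.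
- by move=> u _; rewrite -EFinM lee_fin mulr_ge0.
- by apply: emeasurable_funM => //; exact/measurable_EFinP.
- by move=> u _; rewrite -EFinM lee_fin mulr_ge0//; case: ifP.
- by apply: emeasurable_funM => //; exact/measurable_EFinP.
have -> : (\int[mu]_u ((e / 3)%:E * (K u)%:E) = (e / 3)%:E)%E.
  rewrite ge0_integralZl_EFin//; last 2 first.
  - by move=> u _; rewrite lee_fin.
  - exact/measurable_EFinP.
  by rewrite K1 mule1.
have -> : (\int[mu]_u (2%:E * (if (N%:R <= `|u|)%R then `|K u| else 0)%:E) =
    2%:E * \int[mu]_u (if (N%:R <= `|u|)%R then `|K u| else 0)%:E)%E.
  rewrite ge0_integralZl_EFin//; last first.
  - exact/measurable_EFinP.
  - by move=> u _; rewrite lee_fin; case: ifP.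
apply: (@le_trans _ _ ((e / 3)%:E + 2%:E * (e / 3)%:E)%E).
  by rewrite leeD2l// lee_wpmul2l// lee_fin.
by rewrite -EFinM -EFinD lee_fin; lra.
Qed.

End rescaling.

(** * Frequencies and occupancies of cells *)

Section multinomial.
Context {R : realType} {I : finType}.
Implicit Types p : I -> R.

(** [1 - x <= expR (- x)] gives [expR x <= (1 - x)^-1], and [(1 + x + 2 x^2) (1 - x) = 1 + x^2 (1 -
    2 x)]. Negative [x] is covered too. *)
Lemma expR_le_quad (x : R) : x <= 2^-1 -> expR x <= 1 + x + 2 * x ^+ 2.
Proof.
move=> x1.
have h : 1 - x <= expR (- x) by have := expR_ge1Dx (- x).
have h0 : 0 < 1 - x by lra.
rewrite -[x in leLHS]opprK expRN (le_trans (_ : _ <= (1 - x)^-1))//.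
  by rewrite lef_pV2// posrE expR_gt0.
rewrite -[leLHS]mul1r ler_pdivrMr//.
have : 0 <= x ^+ 2 * (2^-1 - x) * 2.
  by apply: mulr_ge0 => //; apply: mulr_ge0; [exact: sqr_ge0|lra].
lra.
Qed.

(** A sample is represented by the word of its cells, so that probabilities become finite sums over
    words. *)
Definition freq n (w : {ffun 'I_n -> I}) (c : I) : R :=
  n%:R^-1 * \sum_(i < n) (w i == c)%:R.

Definition freq_dev p n (w : {ffun 'I_n -> I}) : R :=
  \sum_(c : I) `|freq w c - p c|.

(** Duality between the l1 norm and signs: [sg] marks the cells whose frequency is too low. For a
    fixed [sg] the summands are independent and centred when the letters of [w] are drawn from
    [p]. *)
Lemma freq_dev_sign p n (w : {ffun 'I_n -> I}) : (0 < n)%N ->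
  exists sg : {ffun I -> bool},
  freq_dev p w = n%:R^-1 * \sum_(i < n) ((-1) ^+ sg (w i) - \sum_c p c * (-1) ^+ sg c).
Proof.
move=> n0; exists [ffun c => freq w c - p c < 0].
rewrite sumrB sumr_const card_ord mulrBr -[X in _ - _ * X]mulr_natl mulKf ?pnatr_eq0 -?lt0n// /freq_dev.
rewrite [X in X - _](_ : _ = \sum_c freq w c * (-1) ^+ (freq w c - p c < 0)%R); last first.
  rewrite /freq; under [RHS]eq_bigr do rewrite -mulrA.
  rewrite -mulr_sumr; congr (_ * _).
  under [RHS]eq_bigr do rewrite mulr_suml.
  rewrite exchange_big/=; apply: eq_bigr => i _.
  rewrite ffunE (bigD1 (w i))//= eqxx mul1r [X in _ = _ + X]big1 ?addr0// => c.
  by rewrite eq_sym => /negbTE ->; rewrite mul0r.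
under [X in _ - X]eq_bigr do rewrite ffunE.
rewrite -sumrB; apply: eq_bigr => c _; rewrite -mulrBl.
case: ltP => h; first by rewrite ltr0_norm// mulrN1.
by rewrite ger0_norm// mulr1.
Qed.

(** Independence in the form of distributivity: with [q] equal to [p] times a function of the cell,
    it evaluates an exponential moment. *)
Lemma sum_prod_ffun n (q : I -> R) :
  \sum_(w : {ffun 'I_n -> I}) \prod_(i < n) q (w i) = (\sum_c q c) ^+ n.
Proof. by rewrite -(bigA_distr_bigA (fun (_ : 'I_n) c => q c)) prodr_const card_ord. Qed.

(* The deviation is the largest of 2 ^ #|I| signed sums of independent terms; a
   Chernoff bound with parameter e / 16 applies to each of them. *)
Lemma freq_dev_tail p n (e : R) : (forall c, 0 <= p c) -> \sum_c p c = 1 ->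
  (0 < n)%N -> 0 < e -> e <= 4 ->
  \sum_(w : {ffun 'I_n -> I} | e < freq_dev p w) \prod_(i < n) p (w i) <=
    2 ^+ #|I| * expR (- (n%:R * e ^+ 2 / 32)).
Proof.
move=> p0 p1 n0 e0 e4.
(* Minimizer of [8 la^2 - la e], the exponent per observation reached below; the minimum is
   [- e^2 / 32]. As [e <= 4], it also keeps the arguments passed to [expR_le_quad] at most 1/2. *)
pose la := e / 16.
pose m (sg : {ffun I -> bool}) := \sum_c p c * (-1) ^+ sg c.
have mle sg : `|m sg| <= 1.
  rewrite -p1 (le_trans (ler_norm_sum _ _ _))// ler_sum// => c _.
  by rewrite normrM normrX normrN1 expr1n mulr1 ger0_norm.
(* Markov's inequality: on the event, the product for the sign pattern of [freq_dev_sign] is at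
   least 1, and the other products are nonnegative. *)
have step1 (w : {ffun 'I_n -> I}) : ((e < freq_dev p w)%R%:R : R) <=
  \sum_(sg : {ffun I -> bool}) \prod_(i < n) expR (la * ((-1) ^+ sg (w i) - m sg - e)).
  have s0 (sg : {ffun I -> bool}) : 0 <= \prod_(i < n) expR (la * ((-1) ^+ sg (w i) - m sg - e)).
    by apply: prodr_ge0 => i _; exact: expR_ge0.
  case: ltP => h; last by rewrite sumr_ge0.
  have [sg hsg] := freq_dev_sign p w n0.
  rewrite (bigD1 sg)//= ler_wpDr ?sumr_ge0//.
  rewrite -expR_sum -mulr_sumr -[leLHS]expR0 ler_expR mulr_ge0//; first by rewrite divr_ge0// ltW.
  rewrite sumrB sumr_const card_ord subr_ge0.
  move: h; rewrite hsg ltr_pdivlMl ?ltr0n// mulr_natl => /ltW.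
  by [].
apply: (@le_trans _ _ (\sum_(w : {ffun 'I_n -> I}) \sum_(sg : {ffun I -> bool})
    \prod_(i < n) (p (w i) * expR (la * ((-1) ^+ sg (w i) - m sg - e))))).
  rewrite big_mkcond/= ler_sum// => w _.
  under [leRHS]eq_bigr do rewrite big_split/=.
  rewrite -mulr_sumr.
  have := step1 w; have : 0 <= \prod_(i < n) p (w i) by apply: prodr_ge0.
  case: ifP => _ h0 h1; first by rewrite ler_peMr.
  by rewrite mulr_ge0.
rewrite exchange_big/=.
have -> : 2 ^+ #|I| = \sum_(sg : {ffun I -> bool}) (1 : R).
  by rewrite sumr_const card_ffun card_bool natrX.
rewrite mulr_suml ler_sum// => sg _; rewrite mul1r.
have /= -> := sum_prod_ffun n (fun c => p c * expR (la * ((-1) ^+ sg c - m sg - e))).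
have -> : expR (- (n%:R * e ^+ 2 / 32)) = expR (- (e ^+ 2 / 32)) ^+ n.
  by rewrite -expRM_natl; congr expR; ring.
apply: lerXn2r; rewrite ?nnegrE ?expR_ge0//.
  by apply: sumr_ge0 => c _; rewrite mulr_ge0 ?expR_ge0.
have la0 : 0 < la by rewrite divr_gt0.
apply: (@le_trans _ _ (\sum_c p c * (expR (- (la * e)) * (1 + la * ((-1) ^+ sg c - m sg) + 8 * la ^+ 2)))).
  apply: ler_sum => c _; apply: ler_wpM2l => //.
  rewrite (_ : la * _ = - (la * e) + la * ((-1) ^+ sg c - m sg)); last ring.
  rewrite expRD ler_wpM2l ?expR_ge0//.
  have hm : `|(-1) ^+ sg c - m sg| <= 2.
    by rewrite (le_trans (ler_normB _ _))// normrX normrN1 expr1n; have := mle sg; lra.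
  apply: (le_trans (expR_le_quad _)).
    rewrite (le_trans (ler_norm _))// normrM gtr0_norm// /la.
    have : 0 <= `|(-1) ^+ sg c - m sg| by [].
    nra.
  rewrite lerD2l exprMn mulrCA mulrC ler_wpM2r ?sqr_ge0//.
  have : `|(-1) ^+ sg c - m sg| ^+ 2 <= 2 ^+ 2 by rewrite ler_sqr ?nnegrE.
  by rewrite real_normK ?num_real//; lra.
under eq_bigr do rewrite mulrCA.
rewrite -mulr_sumr.
(* The linear term cancels because [m sg] is the mean of the signs under [p]. *)
rewrite (_ : \sum_c _ = 1 + 8 * la ^+ 2); last first.
  rewrite (eq_bigr (fun c => p c * (1 - la * m sg + 8 * la ^+ 2) + la * (p c * (-1) ^+ sg c)));
    last by move=> c _; ring.
  rewrite big_split/= -mulr_suml p1 -mulr_sumr -/(m sg); ring.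
apply: (@le_trans _ _ (expR (- (la * e)) * expR (8 * la ^+ 2))).
  by rewrite ler_wpM2l ?expR_ge0// expR_ge1Dx.
rewrite -expRD ler_expR /la le_eqVlt; apply/orP; left; apply/eqP; by field.
Qed.

End multinomial.

Lemma leq_ffact_expn n m : (n ^_ m <= n ^ m)%N.
Proof. by elim: m => // m IH; rewrite ffactnSr expnSr leq_mul// leq_subr. Qed.

(** A single term of the exponential series; it serves as a crude Stirling lower bound for the
    factorial. *)
Lemma expn_fact_le (R : realType) (m : nat) : (m%:R ^+ m : R) <= m`!%:R * expR m%:R.
Proof.
case: m => [|m]; first by rewrite expr0 fact0 mul1r expR0.
have := expR_ge1Dxn m (ler0n R m.+1).
have f0 : 0 < m.+1`!%:R :> R by rewrite ltr0n fact_gt0.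
by move=> h; rewrite mulrC -ler_pdivrMr//; lra.
Qed.

(** * A Borel-Cantelli criterion *)

Section borel_cantelli.
Context {d : measure_display} {T : measurableType d} {R : realType} (P : probability T R).

(** The terms telescope, being [C / n.+1 - C / n.+2]. *)
Lemma series_inv_lt_pinfty (C : R) (N : nat) : 0 <= C ->
  (\sum_(N <= n <oo) (C / (n.+1%:R * n.+2%:R))%:E < +oo)%E.
Proof.
move=> C0.
apply: (@le_lt_trans _ _ C%:E); last exact: ltry.
have tele k : \sum_(0 <= n < k) (C / (n.+1%:R * n.+2%:R)) = C - C / k.+1%:R.
  elim: k => [|k IH]; first by rewrite big_nil divr1 subrr.
  rewrite big_nat_recr//= IH; field.
  by rewrite !gt_eqF// ltr_pwDl.
apply: lime_le.
  by apply: is_cvg_nneseries => n _ _; rewrite lee_fin divr_ge0// mulr_ge0.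
near=> k; rewrite sumEFin lee_fin.
apply: (@le_trans _ _ (\sum_(0 <= n < k) (C / (n.+1%:R * n.+2%:R)))).
  have [Nk|/ltnW kN] := leqP N k; last first.
    by rewrite big_geq// sumr_ge0// => n _; rewrite divr_ge0// mulr_ge0.
  rewrite [leRHS](@big_cat_nat _ _ _ N)//= lerDr sumr_ge0// => n _.
  by rewrite divr_ge0// mulr_ge0.
by rewrite tele gerBl divr_ge0.
Unshelve. all: by end_near. Qed.

Lemma borel_cantelli (E : nat -> set T) (C : R) : 0 <= C ->
  (forall n, measurable (E n)) ->
  (\forall n \near \oo, (P (E n) <= (C / (n.+1%:R * n.+2%:R))%:E)%E) ->
  {ae P, forall w, \forall n \near \oo, ~ E n w}.
Proof.
move=> C0 mE [N _ HN].
(* The bound holds from rank [N] on, so earlier events are replaced by the empty set. *)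
pose F n := if (N <= n)%N then E n else set0.
have mF n : measurable (F n) by rewrite /F; case: ifP.
have PF : P (lim_sup_set F) = 0.
  apply: lim_sup_set_cvg0 => //.
  rewrite (nneseries_split_cond 0 N)//.
  rewrite big_nat_cond big1 ?add0e; last first.
    by move=> i /andP[/andP[_ iN] _]; rewrite /F leqNgt iN measure0.
  apply: le_lt_trans (series_inv_lt_pinfty N C0).
  rewrite add0n; apply: lee_nneseries => // n _.
  rewrite /F; case: ifP => [|_]; first exact: HN.
  by rewrite measure0 lee_fin divr_ge0// mulr_ge0.
exists (lim_sup_set F); split => //.
  by apply: bigcap_measurable => // n _; exact: bigcup_measurable.
move=> w /= Hw n _; apply: contrapT => h; apply: Hw.
exists (maxn n N) => // m /= nm Em; apply: h; exists m => //=.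
  exact: leq_trans (leq_maxl _ _) nm.
by rewrite /F (leq_trans (leq_maxr _ _) nm).
Qed.

End borel_cantelli.

(** * Cell frequencies of an iid sample *)

Section independence.
Context {d : measure_display} {T : measurableType d} {R : realType} (P : probability T R).
Variables (X : nat -> {RV P >-> R}) (X_iid : iid X).

Lemma iid_prod_sub n (J : {set 'I_n}) (B : 'I_n -> set R) : (forall i, measurable (B i)) ->
  P (\bigcap_(i in [set` J]) (X i @^-1` B i)) =
  (\prod_(i in J) distribution P (X 0%N) (B i))%E.
Proof.
move=> mB.
pose J' := [seq val i | i <- enum J].
pose B' (k : nat) := if insub k is Some i then B i else setT.
have B'E (i : 'I_n) : B' i = B i by rewrite /B' valK.
have := X_iid.1 J' B' _ _; rewrite /J' map_inj_uniq ?enum_uniq; last exact: val_inj.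
move=> /(_ isT) H.
rewrite (_ : \bigcap_(i in [set` J]) (X i @^-1` B i) =
   \bigcap_(i in [set` [seq val i | i <- enum J]]) (X i @^-1` B' i)); last first.
  apply/seteqP; split => w /= Hw.
    by move=> k /= /mapP[i]; rewrite mem_enum => iJ ->; rewrite B'E; exact: Hw.
  by move=> i /= iJ; rewrite -B'E; apply: Hw => /=; rewrite map_f// mem_enum.
rewrite H; last by move=> k /mapP[i _ ->]; rewrite B'E.
rewrite big_map big_enum/=; apply: eq_bigr => i _.
by rewrite B'E -(X_iid.2 i).
Qed.

Lemma iid_prod n (B : 'I_n -> set R) : (forall i, measurable (B i)) ->
  P (\bigcap_(i : 'I_n) (X i @^-1` B i)) = (\prod_(i < n) distribution P (X 0%N) (B i))%E.
Proof.
move=> mB; have := @iid_prod_sub n [set: 'I_n]%SET B mB.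
rewrite [in RHS](eq_bigl xpredT); last by move=> i; rewrite finset.in_setT.
move=> <-; congr (P _); apply/seteqP; split => w Hw i _; apply: Hw => //=.
by rewrite finset.in_setT.
Qed.

End independence.

Lemma measure_bigcup_fin_le d (T : measurableType d) (R : realType) (P : {measure set T -> \bar R})
  (J : finType) (A : pred J) (F : J -> set T) : (forall j, measurable (F j)) ->
  (P (\bigcup_(w in [set` A]) F w) <= \sum_(w | A w) P (F w))%E.
Proof.
move=> mF.
have -> : \bigcup_(w in [set` A]) F w = \big[setU/set0]_(w <- enum A) F w.
  rewrite -bigcup_seq; apply: eq_bigcupl.
  by split => j /=; rewrite mem_enum.
rewrite -big_enum/=.
elim: (enum A) => [|j s IH]; first by rewrite !big_nil measure0.
rewrite !big_cons (le_trans (measureU2 _ _ _))//; last exact: leeD.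
by apply: bigsetU_measurable.
Qed.

Section cells.
Context {d : measure_display} {T : measurableType d} {R : realType} (P : probability T R).
Variables (X : nat -> {RV P >-> R}) (X_iid : iid X).

Definition cell_prob {I : finType} (c : R -> I) (j : I) : R :=
  fine (distribution P (X 0%N) (c @^-1` [set j])).

Definition sample_cells {I : finType} (c : R -> I) n (w : T) : {ffun 'I_n -> I} :=
  [ffun i : 'I_n => c (X i w)].

Variable I : finType.
Variable c : R -> I.
Hypothesis mc : forall j, measurable (c @^-1` [set j]).

Lemma cell_probE j : (cell_prob c j)%:E = distribution P (X 0%N) (c @^-1` [set j]).
Proof. by rewrite /cell_prob fineK// fin_num_measure. Qed.

Lemma cell_prob_ge0 j : 0 <= cell_prob c j.
Proof. by rewrite -lee_fin cell_probE. Qed.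

Lemma sum_cell_prob : \sum_j cell_prob c j = 1.
Proof.
apply/EFin_inj; rewrite -sumEFin; under eq_bigr do rewrite cell_probE.
rewrite -(probability_setT (distribution P (X 0%N))).
rewrite (_ : setT = \bigcup_(j in [set` xpredT]) (c @^-1` [set j])); last first.
  by apply/seteqP; split => // x _; exists (c x).
rewrite measure_fin_bigcup//=.
- rewrite (fsbigE (index_enum I)) ?index_enum_uniq//.
    by apply: eq_bigl => j; apply/esym; exact: mem_set.
  by move=> j _; rewrite mem_index_enum.
- by move=> i j _ _ [x [/= <- <-]].
Qed.

Lemma measurable_sample_cells n (w : {ffun 'I_n -> I}) :
  measurable [set t | sample_cells c n t = w] /\
  P [set t | sample_cells c n t = w] = (\prod_(i < n) cell_prob c (w i))%:E.
Proof.
have E : [set t | sample_cells c n t = w] = \bigcap_(i : 'I_n) (X i @^-1` (c @^-1` [set w i])).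
  apply/seteqP; split => t /=; first by move=> <- i _ /=; rewrite ffunE.
  by move=> H; apply/ffunP => i; rewrite ffunE; exact: H.
split.
  rewrite E; apply: fin_bigcap_measurable => // i _.
  by rewrite -[X in measurable X]setTI; exact: measurable_funPT.
rewrite E (iid_prod X_iid)// -prodEFin; apply: eq_bigr => i _.
by rewrite cell_probE.
Qed.

Lemma sample_cells_event n (A : pred {ffun 'I_n -> I}) :
  measurable [set t | A (sample_cells c n t)] /\
  (P [set t | A (sample_cells c n t)] <= (\sum_(w | A w) \prod_(i < n) cell_prob c (w i))%:E)%E.
Proof.
have E : [set t | A (sample_cells c n t)] =
   \bigcup_(w in [set` A]) [set t | sample_cells c n t = w].
  apply/seteqP; split => t /=; first by move=> At; exists (sample_cells c n t).
  by move=> [w /= Aw ->].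
have mE w := (@measurable_sample_cells n w).1.
split; first by rewrite E; apply: fin_bigcup_measurable => // w _.
rewrite E -sumEFin.
under eq_bigr do rewrite -(@measurable_sample_cells n _).2.
exact: measure_bigcup_fin_le.
Qed.

Lemma sample_freq_dev_prob n (e : R) : (0 < n)%N -> 0 < e -> e <= 4 ->
  measurable [set t | (e < freq_dev (cell_prob c) (sample_cells c n t))%R] /\
  (P [set t | (e < freq_dev (cell_prob c) (sample_cells c n t))%R] <=
    (2 ^+ #|I| * expR (- (n%:R * e ^+ 2 / 32)))%:E)%E.
Proof.
move=> n0 e0 e4.
have [H1 H2] := sample_cells_event (fun w : {ffun 'I_n -> I} => e < freq_dev (cell_prob c) w).
split=> //; apply: (le_trans H2); rewrite lee_fin; apply: freq_dev_tail => //.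
  exact: cell_prob_ge0.
exact: sum_cell_prob.
Qed.

End cells.

(** The number of cells may grow linearly with [n]: the factor [2 ^ cells] is at most [expR cells],
    which, up to the constant [expR C], uses up half of the exponent [n e^2 / 32] of the tail
    bound. *)
Lemma freq_dev_eventually d (T : measurableType d) (R : realType) (P : probability T R)
    (X : nat -> {RV P >-> R}) (X_iid : iid X) (m : nat -> nat) (c : forall n, R -> 'I_(m n).+1)
    (e C : R) : 0 < e -> e <= 4 -> 0 <= C ->
  (forall n j, measurable (c n @^-1` [set j])) ->
  (\forall n \near \oo, (m n).+1%:R <= n%:R * e ^+ 2 / 64 + C) ->
  {ae P, forall w, \forall n \near \oo,
     freq_dev (cell_prob X (c n)) (sample_cells X (c n) n w) <= e}.
Proof.
move=> e0 e4 C0 mc mn.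
pose E n := if n is 0%N then set0 else
  [set t | (e < freq_dev (cell_prob X (c n)) (sample_cells X (c n) n t))%R].
have mE n : measurable (E n).
  by case: n => [|n]; [exact: measurable0|exact: (sample_freq_dev_prob X_iid (mc n.+1) (ltn0Sn n) e0 e4).1].
pose D := 64 / e ^+ 2.
(* With [x = n / D] the remaining factor satisfies [expR (- x) <= 6 / x^3], while
   [(n + 1) (n + 2) <= 6 n^3]. *)
pose B := expR C * (D ^+ 3 * 36).
have D0 : 0 < D by rewrite divr_gt0// exprn_gt0.
have B0 : 0 <= B by rewrite mulr_ge0 ?expR_ge0// mulr_ge0// exprn_ge0// ltW.
have H : \forall n \near \oo, (P (E n) <= (B / (n.+1%:R * n.+2%:R))%:E)%E.
  near=> n.
  have n0 : (0 < n)%N by near: n; exists 1%N.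
  have -> : E n = [set t | (e < freq_dev (cell_prob X (c n)) (sample_cells X (c n) n t))%R].
    by case: (n) n0.
  apply: (le_trans (sample_freq_dev_prob X_iid (mc n) n0 e0 e4).2).
  rewrite lee_fin card_ord.
  have h2 : 2 ^+ (m n).+1 <= expR (n%:R * e ^+ 2 / 64 + C).
    apply: (@le_trans _ _ (expR (m n).+1%:R)); last by rewrite ler_expR; near: n.
    rewrite -[X in expR X]mulr1 expRM_natl lerXn2r ?nnegrE ?expR_ge0//.
    by rewrite (le_trans _ (expR_ge1Dx 1)).
  apply: (@le_trans _ _ (expR (n%:R * e ^+ 2 / 64 + C) * expR (- (n%:R * e ^+ 2 / 32)))).
    by rewrite ler_wpM2r ?expR_ge0.
  rewrite -expRD (_ : _ + _ = C - n%:R / D); last by rewrite /D invf_div; field.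
  rewrite expRD /B -mulrA ler_wpM2l ?expR_ge0//.
  have n1 : 1 <= n%:R :> R by rewrite ler1n.
  pose x : R := n%:R / D.
  have x0 : 0 < x by rewrite divr_gt0// ltr0n.
  have e3 := expR_ge1Dxn 2 (ltW x0).
  have ex : 0 < expR x by exact: expR_gt0.
  have e3' : x ^+ 3 / 6 <= expR x by have : (3`!%:R : R) = 6 by []; move=> <-; lra.
  rewrite expRN ler_pdivlMr ?mulr_gt0// mulrC ler_pdivrMr//.
  have nx : n%:R = x * D by rewrite /x divfK// gt_eqF.
  apply: (@le_trans _ _ (6 * (n%:R ^+ 3))).
    have -> : n.+1%:R = n%:R + 1 :> R by rewrite natr1.
    have -> : n.+2%:R = n%:R + 2 :> R by rewrite -[n.+2]addn2 natrD.
    have -> : (n%:R + 1 : R) * (n%:R + 2) = n%:R ^+ 2 + 3 * n%:R + 2 by ring.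
    have : 0 <= (n%:R - 1) * (6 * n%:R ^+ 2 + 5 * n%:R + 2) :> R.
      by rewrite mulr_ge0 ?subr_ge0// !addr_ge0// mulr_ge0// exprn_ge0.
    by lra.
  rewrite nx mulfK ?gt_eqF// exprMn.
  have := ler_wpM2l (ltW (exprn_gt0 3 D0)) e3'. lra.
have := borel_cantelli B0 mE H.
apply: filterS => w [N _ HN]; near=> n.
have Nn : (N <= n)%N by near: n; exists N.
have n0 : (0 < n)%N by near: n; exists 1%N.
have := HN n Nn; rewrite /E; case: (n) n0 => // k _ /=.
by move=> /negP; rewrite -leNgt.
Unshelve. all: by end_near. Qed.

(** * The largest number of observations in a cell *)

Section occupancy.
Context {d : measure_display} {T : measurableType d} {R : realType} (P : probability T R).
Variables (X : nat -> {RV P >-> R}) (X_iid : iid X).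
Variable kap : R -> nat.
Hypothesis mkap : forall k, measurable (kap @^-1` [set k]).

Definition occupancy n (w : T) k : nat := \sum_(i < n) (kap (X i w) == k).

Let p k : R := fine (distribution P (X 0%N) (kap @^-1` [set k])).

Let pE k : (p k)%:E = distribution P (X 0%N) (kap @^-1` [set k]).
Proof. by rewrite /p fineK// fin_num_measure. Qed.

Let p0 k : 0 <= p k. Proof. by rewrite -lee_fin pE. Qed.

Let sum_p : (\sum_(0 <= k <oo) (p k)%:E = 1)%E.
Proof.
under eq_eseriesr do rewrite pE.
rewrite -(@probability_setT _ _ _ (distribution P (X 0%N))).
rewrite (_ : setT = \bigcup_k (kap @^-1` [set k])); last first.
  by apply/seteqP; split => // y _; exists (kap y).
rewrite measure_bigcup//=; last by move=> i j _ _ [y [/= <- <-]].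
by apply: eq_eseriesl => i; rewrite in_setT.
Qed.

(* Union bound over the cells k and the m.+1-subsets of the sample; since every
   p k ^ m.+1 is at most q ^ m * p k, the sum over the infinitely many cells is
   at most q ^ m. *)
Lemma occupancy_prob n m (q : R) : (forall k, p k <= q) ->
  measurable [set w | exists k, (m < occupancy n w k)%N] /\
  (P [set w | exists k, (m < occupancy n w k)%N] <= ('C(n, m.+1)%:R * q ^+ m)%:E)%E.
Proof.
move=> pq.
pose G k (J : {set 'I_n}) := \bigcap_(i in [set` J]) (X i @^-1` (kap @^-1` [set k])).
pose F k := \bigcup_(J in [set` [pred J : {set 'I_n} | #|J| == m.+1]]) G k J.
have mG k J : measurable (G k J).
  apply: fin_bigcap_measurable => // i _.
  by rewrite -[X in measurable X]setTI; exact: measurable_funPT.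
have mF k : measurable (F k) by apply: fin_bigcup_measurable.
have E : [set w | exists k, (m < occupancy n w k)%N] = \bigcup_k F k.
  apply/seteqP; split => w /=.
    move=> [k hk]; exists k => //.
    pose S := [set i : 'I_n | kap (X i w) == k]%SET.
    have cS : (m.+1 <= #|S|)%N.
      rewrite (leq_trans hk)// /occupancy -sum1dep_card [leqRHS]big_mkcond/=.
      by apply: leq_sum => i _; case: eqP.
    have : (0 < #|[set A : {set 'I_n} | A \subset S & #|A| == m.+1]|)%N.
      by rewrite cards_draws bin_gt0.
    move=> /card_gt0P[J]; rewrite inE => /andP[JS cJ].
    exists J => //= i /= iJ; have := fintype.subsetP JS i iJ; rewrite inE => /eqP //.
  move=> [k _ [J /= /eqP cJ HJ]]; exists k.
  rewrite -cJ /occupancy -sum1_card big_mkcond/=; apply: leq_sum => i _.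
  by case: ifPn => // iJ; have /= -> := HJ i iJ; rewrite eqxx.
split; first by rewrite E; exact: bigcup_measurable.
rewrite E (le_trans (generalized_Boole_inequality _ _ _))//; first exact: bigcup_measurable.
have PF k : (P (F k) <= ('C(n, m.+1)%:R * q ^+ m)%:E * (p k)%:E)%E.
  apply: (le_trans (measure_bigcup_fin_le _ _ (mG k))).
  rewrite (eq_bigr (fun=> ((p k) ^+ m.+1)%:E)); last first.
    move=> J /eqP cJ.
    transitivity (\prod_(i in J) distribution P (X 0%N) (kap @^-1` [set k]))%E.
      exact: (iid_prod_sub X_iid J (B := fun=> kap @^-1` [set k])).
    by under eq_bigr do rewrite -pE; rewrite prodEFin prodr_const cJ.
  rewrite sumEFin sumr_const -EFinM lee_fin.
  rewrite (_ : #|_| = 'C(n, m.+1)); last first.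
    rewrite -[n in 'C(n, _)]card_ord -card_draws; apply: eq_card => J.
    by rewrite !inE.
  rewrite -[leLHS]mulr_natl -mulrA ler_wpM2l// exprS mulrC ler_wpM2r//.
  by rewrite lerXn2r// nnegrE// (le_trans (p0 k)).
apply: (@le_trans _ _ (\sum_(0 <= k <oo) (('C(n, m.+1)%:R * q ^+ m)%:E * (p k)%:E))%E).
  by apply: lee_nneseries => // k _; exact: PF.
have q0 : 0 <= q := le_trans (p0 0%N) (pq 0%N).
rewrite nneseriesZl//; first by rewrite sum_p mule1.
- by move=> k _; rewrite lee_fin.
Qed.

End occupancy.

(** With [j] the integer part of [S = e n s n] and [q = B n^(- al)], [occupancy_prob] gives at most
    [n (n q)^j / j!]. This is at most [n expR (- j)] once [j >= n q (expR 1)^2]: one factor [expR 1]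
    pays for the factorial, the other is the gain. The divergence hypothesis provides this
    inequality, and the square root hypothesis gives [j >= sqrt n], hence summability. *)
Lemma occupancy_eventually d (T : measurableType d) (R : realType) (P : probability T R)
    (X : nat -> {RV P >-> R}) (X_iid : iid X) (kap : nat -> R -> nat)
    (al B e : R) (s : nat -> R) : 0 < B -> 0 < e ->
  (forall n k, measurable (kap n @^-1` [set k])) ->
  (forall n k, (0 < n)%N -> fine (distribution P (X 0%N) (kap n @^-1` [set k])) <= B * n%:R `^ (- al)) ->
  n%:R `^ al * s n @[n --> \oo] --> +oo ->
  (\forall n \near \oo, Num.sqrt n%:R <= e / 4 * (n%:R * s n)) ->
  {ae P, forall w, \forall n \near \oo, forall k,
     (occupancy X (kap n) n w k)%:R <= e * (n%:R * s n)}.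
Proof.
move=> B0 e0 mkap pk s_up s_lo.
pose j n := Num.truncn (e * (n%:R * s n)).
pose E n := [set w | exists k, (j n < occupancy X (kap n) n w k)%N].
(* [4320 = 6 * 720]: [r^6 / 6! <= expR r] is used with [r = sqrt n], together with
   [(n + 1) (n + 2) <= 6 n^2]. *)
have [C CE C0] : exists2 C : R, C = 4320%:R & 0 <= C by exists 4320%:R; rewrite ?ler0n.
have H : \forall n \near \oo, (P (E n) <= (C / (n.+1%:R * n.+2%:R))%:E)%E.
  near=> n.
  (* This gives [S >= 16], so that truncation loses at most half: [S / 2 <= j n]. *)
  have n4 : (16 <= n)%N by near: n; exact: nbhs_infty_ge.
  have n0 : (0 < n)%N by rewrite (leq_trans _ n4).
  have n0' : 0 < n%:R :> R by rewrite ltr0n.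
  have lo : Num.sqrt n%:R <= e / 4 * (n%:R * s n) by near: n.
  have sq4 : 4 <= Num.sqrt n%:R :> R.
    rewrite -[4]ger0_norm// -sqrtr_sqr ler_sqrt ?ler0n//.
    by rewrite (_ : 4 ^+ 2 = 16%:R) ?ler_nat//; ring.
  have up : B * expR 1 * expR 1 * 2 / e <= n%:R `^ al * s n.
    by near: n; move/cvgryPge: s_up; exact.
  set S := e * (n%:R * s n).
  have Slo : 4 * Num.sqrt n%:R <= S by move: lo; rewrite /S; lra.
  have S0 : 0 <= S by lra.
  have jS : S < (j n).+1%:R by exact: truncnS_gt.
  have jlo : S / 2 <= (j n)%:R by move: jS; rewrite -natr1; lra.
  have j0 : 0 < (j n)%:R :> R by lra.
  have j0n : (0 < j n)%N by rewrite -(ltr0n R).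
  apply: (le_trans (occupancy_prob X_iid (mkap n) n (j n) (fun k => pk n k n0)).2).
  rewrite lee_fin.
  set q := B * n%:R `^ (- al).
  have q0 : 0 < q by rewrite mulr_gt0// powR_gt0.
  have s1 : ('C(n, (j n).+1)%:R : R) <= n%:R ^+ (j n).+1 / (j n)`!%:R.
    have : ('C(n, (j n).+1) * (j n)`! <= n ^ (j n).+1)%N.
      apply: (@leq_trans (n ^_ (j n).+1)); last exact: leq_ffact_expn.
      rewrite -bin_ffact leq_mul2l; apply/orP; right.
      by rewrite factS leq_pmull.
    by rewrite -(ler_nat R) natrM natrX ler_pdivlMr ?ltr0n ?fact_gt0.
  have s2 : (j n)%:R ^+ (j n) / expR (j n)%:R <= (j n)`!%:R :> R.
    by rewrite ler_pdivrMr ?expR_gt0//; exact: expn_fact_le.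
  have s3 : n%:R * q * expR 1 * expR 1 <= (j n)%:R.
    apply: le_trans jlo; rewrite /S /q ler_pdivlMr// powRN.
    move: up; rewrite ler_pdivrMr// => up.
    have pw : 0 < n%:R `^ al :> R by rewrite powR_gt0.
    rewrite (_ : _ * 2 = n%:R * (B * expR 1 * expR 1 * 2) / n%:R `^ al); last first.
      by field; rewrite gt_eqF.
    rewrite ler_pdivrMr// [leRHS](_ : _ = n%:R * (n%:R `^ al * s n * e)); last by ring.
    by rewrite ler_wpM2l// ltW.
  have main : 'C(n, (j n).+1)%:R * q ^+ j n <= n%:R * expR (- (j n)%:R).
    have s2' : (j n)`!%:R^-1 <= expR (j n)%:R / (j n)%:R ^+ (j n) :> R.
      rewrite -[leRHS]invrK invf_div lef_pV2 ?posrE ?ltr0n ?fact_gt0//.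
      by rewrite divr_gt0 ?exprn_gt0 ?expR_gt0.
    apply: (@le_trans _ _ (n%:R * (n%:R * q) ^+ (j n) * (expR (j n)%:R / (j n)%:R ^+ (j n)))).
      rewrite [leRHS](_ : _ = n%:R ^+ (j n).+1 * (expR (j n)%:R / (j n)%:R ^+ (j n)) * q ^+ (j n)); last first.
        by rewrite exprMn exprS; ring.
      apply: ler_wpM2r; first by rewrite exprn_ge0// ltW.
      by apply: (le_trans s1); rewrite ler_wpM2l ?exprn_ge0.
    rewrite -mulrA ler_wpM2l// expRN.
    have EE : expR (j n)%:R = expR 1 ^+ (j n) :> R by rewrite -[X in expR X]mulr1 expRM_natl.
    rewrite EE mulrA ler_pdivrMr ?exprn_gt0// ler_pdivlMl ?exprn_gt0 ?expR_gt0//.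
    rewrite -!exprMn lerXn2r ?nnegrE//.
    - by rewrite !mulr_ge0 ?expR_ge0// ltW.
    - by rewrite [leLHS](_ : _ = n%:R * q * expR 1 * expR 1)//; ring.
  apply: (le_trans main).
  pose r := Num.sqrt n%:R : R.
  have r2 : n%:R = r ^+ 2 by rewrite sqr_sqrtr.
  have r0 : 0 < r by rewrite /r; lra.
  have rj : r <= (j n)%:R by rewrite /r; lra.
  have e6 := expR_ge1Dxn 5 (ltW r0).
  have e6' : r ^+ 6 / 720 <= expR (j n)%:R.
    have er : expR r <= expR (j n)%:R by rewrite ler_expR.
    have f6 : (6`! = 720)%N by [].
    by rewrite f6 in e6; lra.
  rewrite expRN ler_pdivrMr ?expR_gt0// mulrAC ler_pdivlMr ?mulr_gt0//.
  have -> : n.+1%:R = n%:R + 1 :> R by rewrite natr1.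
  have -> : n.+2%:R = n%:R + 2 :> R by rewrite -[n.+2]addn2 natrD.
  have n1 : 1 <= n%:R :> R by rewrite ler1n.
  apply: (@le_trans _ _ (n%:R * (6 * n%:R ^+ 2))).
    rewrite ler_wpM2l//.
    have -> : (n%:R + 1 : R) * (n%:R + 2) = n%:R ^+ 2 + 3 * n%:R + 2 by ring.
    have : 0 <= (n%:R - 1) * (5 * n%:R + 2) :> R by rewrite mulr_ge0 ?subr_ge0// addr_ge0// mulr_ge0.
    lra.
  rewrite r2 (_ : r ^+ 2 * _ = C * (r ^+ 6 / 720)); last by rewrite CE; field.
  by rewrite ler_wpM2l.
have mE n : measurable (E n).
  case: (posnP n) => [->|n0]; last first.
    exact: (occupancy_prob X_iid (mkap n) n (j n) (fun k => pk n k n0)).1.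
  rewrite (_ : E 0%N = set0)//; apply/seteqP; split => // w [k].
  by rewrite /occupancy big_ord0.
have := borel_cantelli C0 mE H.
apply: filterS => w [N _ HN]; near=> n => k.
have Nn : (N <= n)%N by near: n; exists N.
have lo : Num.sqrt n%:R <= e / 4 * (n%:R * s n) by near: n.
have S0 : 0 <= e * (n%:R * s n) by have := sqrtr_ge0 (n%:R : R); lra.
have := HN n Nn => /forallNP/(_ k)/negP; rewrite -leqNgt => h.
by rewrite (le_trans _ (_ : (j n)%:R <= _)) ?ler_nat// truncn_le.
Unshelve. all: by end_near. Qed.

(** * Grids on the line and their cell probabilities *)

Section grids.
Context {R : realType}.

(** Every set of naturals is measurable, so countably many preimages of points suffice. The value 0
    is treated apart because it is also taken on all negative reals. *)
Lemma measurable_truncn : measurable_fun [set: R] (Num.truncn : R -> nat).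
Proof.
move=> _ Y _; rewrite setTI.
rewrite (_ : _ @^-1` Y = \bigcup_(k in Y) (Num.truncn @^-1` [set k])); last first.
  by apply/seteqP; split => [y Yy|y [k Yk /= yk]]; [exists (Num.truncn y)|rewrite /preimage/= yk].
apply: bigcup_measurable => -[|k] _.
  rewrite (_ : _ @^-1` _ = [set` `]-oo, (1 : R)[]); first exact: measurable_itv.
  apply/seteqP; split => y /=; rewrite in_itv/=.
    by move=> h; have := truncnS_gt y; rewrite h.
  by move=> h; apply/eqP; rewrite -leqn0 leqNgt truncn_gt0 -ltNge.
rewrite (_ : _ @^-1` _ = [set` `[k.+1%:R, (k.+2%:R : R)[]); first exact: measurable_itv.
apply/seteqP; split => y /=; rewrite in_itv/=.
  move=> h; have y0 : 0 <= y.
    by rewrite (le_trans _ (_ : 1 <= y))// -truncn_gt0 h.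
  by have := truncn_itv y0; rewrite h.
by move=> h; exact: truncn_def.
Qed.

Lemma measurable_abs_cell (del : R) k :
  measurable ((fun y : R => Num.truncn (`|y| / del)) @^-1` [set k]).
Proof.
rewrite -[X in measurable X]setTI.
have mf : measurable_fun setT (fun y : R => Num.truncn (`|y| / del)).
  by apply: (measurableT_comp measurable_truncn); apply: measurable_funM.
exact: mf.
Qed.

Lemma measurable_if_cell m (Q : R -> bool) (G : R -> nat) (k : nat) (j : 'I_m.+1) :
  measurable_fun setT Q -> measurable_fun setT G ->
  measurable ((fun y => inord (if Q y then G y else k) : 'I_m.+1) @^-1` [set j]).
Proof.
move=> mQ mG; rewrite -[X in measurable X]setTI.
have mf : measurable_fun setT (fun y => if Q y then G y else k) by apply: measurable_fun_ifT.
have := mf measurableT [set i | inord i = j :> 'I_m.+1]; apply.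
by [].
Qed.

(* [ord_max] is the index of the complement of [-B, B[. *)
Definition grid_cell m (B del : R) (y : R) : 'I_m.+1 :=
  inord (if - B <= y < B then minn (Num.truncn ((y + B) / del)) m else m).

Definition grid_point m (B del : R) (j : 'I_m.+1) : R := j%:R * del - B.

Lemma measurable_grid_cell m (B del : R) j : measurable (@grid_cell m B del @^-1` [set j]).
Proof.
apply: measurable_if_cell.
  apply: measurable_and; first exact: measurable_fun_ler.
  exact: measurable_fun_ltr.
have mm : measurable_fun setT (fun k => minn k m) by [].
apply: (measurableT_comp mm); apply: (measurableT_comp measurable_truncn).
by apply: measurable_funM => //; exact: measurable_funD.
Qed.

Lemma grid_cell_in m (B del y : R) : 0 < del -> 2 * B / del <= m%:R ->
  grid_cell m B del y != ord_max -> `|y - grid_point B del (grid_cell m B del y)| <= del.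
Proof.
move=> del0 Bm; rewrite /grid_cell /grid_point; case: ifPn => [/andP[y1 y2]|_]; last first.
  by move=> /eqP[]; apply/val_inj; rewrite /= inordK.
move=> _.
have yB : 0 <= (y + B) / del by apply: divr_ge0; [lra|exact: ltW].
have ty := truncn_itv yB.
have tm : (Num.truncn ((y + B) / del) <= m)%N.
  rewrite -(ler_nat R); apply: (le_trans (andP ty).1); apply: le_trans Bm.
  by rewrite ler_wpM2r ?invr_ge0 ?ltW//; lra.
rewrite (minn_idPl tm) inordK//.
move: ty => /andP[t1 t2]; rewrite ler_pdivlMr// in t1.
rewrite ltr_pdivrMr// -natr1 mulrDl mul1r in t2.
by rewrite ler_norml; apply/andP; split; lra.
Qed.

(** The strict inequality keeps the index of every point of [[- B, B[] below [m]. *)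
Lemma grid_cell_out m (B del y : R) : 0 < del -> 2 * B / del < m%:R ->
  grid_cell m B del y = ord_max -> B <= `|y|.
Proof.
move=> del0 Bm; rewrite /grid_cell; case: ifPn => [/andP[y1 y2] /(congr1 val)/=|].
  rewrite inordK ?ltnS ?geq_minr// => /minn_idPr.
  rewrite truncn_ge_nat; last by apply: divr_ge0; [lra|exact: ltW].
  move=> h; exfalso; have : (y + B) / del <= 2 * B / del by rewrite ler_wpM2r ?invr_ge0 ?ltW//; lra.
  lra.
by rewrite negb_and -!ltNge -leNgt ler_normr => /orP[] ? _; apply/orP; lra.
Qed.

End grids.

Section holder.
Context {d : measure_display} {T : measurableType d} {R : realType} (P : probability T R).
Variable X : {RV P >-> R}.

Lemma distribution_oc (a b : R) : a <= b ->
  fine (distribution P X `]a, b]%classic) =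
  distribution_function X b - distribution_function X a.
Proof.
move=> ab; rewrite /distribution_function /cdf.
rewrite (_ : [set` `]-oo, b]] = [set` `]-oo, a]] `|` [set` `]a, b]]); last first.
  apply/seteqP; split => y /=; rewrite !in_itv/=.
    by move=> yb; have [ya|ya] := leP y a; [left|right; apply/andP].
  by move=> [ya|/andP[]//]; exact: le_trans ab.
rewrite measureU//; last first.
  by apply/seteqP; split => // y [] /=; rewrite !in_itv/= => ya /andP[]; rewrite ltNge ya.
by rewrite fineD ?fin_num_measure// addrAC subrr add0r.
Qed.

(* Cells are taken in the absolute value of y, so that they are indexed by nat. *)
Lemma abs_cell_prob (C al del : R) k : 0 < C -> 0 < al -> 0 < del ->
  (forall x y, `|distribution_function X x - distribution_function X y| <= C * `|x - y| `^ al) ->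
  fine (distribution P X ((fun y : R => Num.truncn (`|y| / del)) @^-1` [set k])) <=
    2 * C * (2 * del) `^ al.
Proof.
move=> C0 al0 del0 hF.
(* [distribution_oc] evaluates intervals []a, b]], whereas the nonnegative part of a cell is closed
   on the left. Lengthening both intervals by one mesh covers the cell and is the origin of
   [2 * del]. *)
pose I1 := `](k%:R - 1) * del, (k%:R + 1) * del]%classic : set R.
pose I2 := `](- (k%:R + 1)) * del, (- (k%:R - 1)) * del]%classic : set R.
have mI1 : measurable I1 by exact: measurable_itv.
have mI2 : measurable I2 by exact: measurable_itv.
have sub : (fun y : R => Num.truncn (`|y| / del)) @^-1` [set k] `<=` I1 `|` I2.
  move=> y /= yk; have yd : 0 <= `|y| / del by apply: divr_ge0 => //; exact: ltW.
  have := truncn_itv yd; rewrite yk.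
  rewrite ler_pdivlMr// ltr_pdivrMr// -natr1 => /andP[h1 h2].
  rewrite /I1 /I2 /= !in_itv/=; have [y0|y0] := leP 0 y.
    by left; move: h1 h2; rewrite ger0_norm//; nra.
  by right; move: h1 h2; rewrite ltr0_norm//; nra.
have le1 : fine (distribution P X I1) <= C * (2 * del) `^ al.
  rewrite distribution_oc; last by rewrite ler_wpM2r ?ltW//; lra.
  rewrite (le_trans (ler_norm _))// (le_trans (hF _ _))// -mulrBl.
  by rewrite (_ : k%:R + 1 - (k%:R - 1) = 2); [rewrite gtr0_norm// mulr_gt0|ring].
have le2 : fine (distribution P X I2) <= C * (2 * del) `^ al.
  rewrite distribution_oc; last by rewrite ler_wpM2r ?ltW//; lra.
  rewrite (le_trans (ler_norm _))// (le_trans (hF _ _))// -mulrBl.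
  by rewrite (_ : - (k%:R - 1) - - (k%:R + 1) = 2); [rewrite gtr0_norm// mulr_gt0|ring].
rewrite -lee_fin fineK ?fin_num_measure//; last exact: measurable_abs_cell.
apply: (@le_trans _ _ (distribution P X (I1 `|` I2))).
  by apply: le_measure => //; rewrite inE; [exact: measurable_abs_cell|exact: measurableU].
apply: (le_trans (measureU2 _ _ _)) => //.
rewrite -[X in (X + _)%E]fineK ?fin_num_measure// -[X in (_ + X)%E]fineK ?fin_num_measure//.
by rewrite -EFinD lee_fin; lra.
Qed.

End holder.

(** * The bandwidth *)

Section distances.
Context {R : realType}.

(* What the argument uses of [d_infty] and [d_kuip]. *)
Definition distance_like (k : nat) (d : (R -> R) -> (R -> R) -> \bar R) :=
  (forall F G e, (forall x, `|F x - G x| <= e) -> (d F G <= (2 * k%:R * e)%:E)%E) /\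
  (forall F G a b, a <= b -> (`|(F b - F a) - (G b - G a)|%:E <= 2%:E * d F G)%E).

Lemma d_infty_like : distance_like 1 (@d_infty R).
Proof.
split=> [F G e Fe|F G a b ab].
  apply: ub_ereal_sup => _ [x _ <-]; rewrite lee_fin.
  by have := Fe x; have := normr_ge0 (F x - G x); lra.
have H x : (`|F x - G x|%:E <= d_infty F G)%E by apply: ereal_sup_ubound; exists x.
rewrite (_ : F b - F a - _ = (F b - G b) - (F a - G a)); last ring.
apply: (@le_trans _ _ (`|F b - G b|%:E + `|F a - G a|%:E)%E).
  by rewrite -EFinD lee_fin ler_normB.
rewrite -[2%R]/(1 + 1)%R EFinD ge0_muleDl// mul1e.
by apply: leeD.
Qed.

Lemma d_kuip_like k : (1 <= k)%N -> distance_like k (@d_kuip R k).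
Proof.
move=> k1; split=> [F G e Fe|F G a b ab].
  apply: ub_ereal_sup => _ [[a b] /= _ <-]; rewrite lee_fin.
  apply: (@le_trans _ _ (\sum_(i < k) (2 * e))).
    apply: ler_sum => i _.
    rewrite (_ : F _ - F _ - _ = (F (b i) - G (b i)) - (F (a i) - G (a i))); last ring.
    rewrite (le_trans (ler_normB _ _))//.
    by have := Fe (b i); have := Fe (a i); lra.
  by rewrite sumr_const card_ord -[leLHS]mulr_natl; lra.
have H : (`|(F b - F a) - (G b - G a)|%:E <= d_kuip k F G)%E.
  (* Witness for the supremum: the first interval is [[a, b]], the others are degenerate at [b]. *)
  apply: (@le_trans _ _ (\sum_(i < k) `|(F b - F (if val i == 0 then a else b)) -
    (G b - G (if val i == 0 then a else b))|)%:E).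
    case: k k1 => // k _.
    by rewrite lee_fin big_ord_recl/= lerDl sumr_ge0.
  apply: ereal_sup_ubound; exists ((fun i : 'I_k => if val i == 0 then a else b), fun=> b) => //=.
  split => [i|i j /= ->//]; by case: ifP.
rewrite (le_trans H)// -[2%R]/(1 + 1)%R EFinD ge0_muleDl// mul1e leeDl//.
exact: le_trans H.
Qed.

End distances.

(** * The smoothed distribution function at small bandwidths *)

Section kernel_df_lemmas.
Context {R : realType}.
Local Notation mu := (@lebesgue_measure R).
Variable K : R -> R.
Hypothesis K_density : probability_density K.

Let mK : measurable_fun setT K. Proof. by case: K_density. Qed.
Let K0 x : 0 <= K x. Proof. by case: K_density. Qed.
Let K1 : (\int[mu]_x (K x)%:E = 1)%E. Proof. by case: K_density. Qed.

Lemma measurable_empirical_df n (x : nat -> R) t h :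
  measurable_fun setT (fun y : R => empirical_df n x (t - h * y)).
Proof.
apply: measurable_funM; first exact: measurable_cst.
apply: measurable_sum => i.
rewrite (_ : (fun y : R => _) = (fun y : R => if x i <= t - h * y then 1 else 0)); last first.
  by apply/funext => y; case: ifP.
apply: measurable_fun_ifT => //; apply: measurable_fun_ler => //.
by apply: measurable_funB => //; exact: measurable_funM.
Qed.

Lemma empirical_df_ge0 n (x : nat -> R) t : 0 <= empirical_df n x t.
Proof. by rewrite mulr_ge0 ?invr_ge0// sumr_ge0. Qed.

Lemma empirical_df_le1 n (x : nat -> R) t : empirical_df n x t <= 1.
Proof.
rewrite /empirical_df; have [->|n0] := posnP n; first by rewrite big_ord0 mulr0.
rewrite ler_pdivrMl ?ltr0n// mulr1 -[X in _ <= X%:R]card_ord -sumr_const ler_sum// => i _.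
by rewrite lern1 leq_b1.
Qed.

(** Convolution may act on either factor: [u = x i + h y] in each summand turns the integral of the
    density estimate up to [t] into a [K]-average of shifts of the empirical distribution function.
    Both bandwidth bounds rest on this form. *)
Lemma kernel_dfE n h (x : nat -> R) t : (0 < n)%N -> 0 < h ->
  (\int[mu]_y (K y * empirical_df n x (t - h * y))%:E = (kernel_df K n h x t)%:E)%E.
Proof.
move=> n0 h0.
have n0' : 0 < n%:R :> R by rewrite ltr0n.
have mE := measurable_empirical_df n x t h.
(* A real-valued integral is the [fine] of an extended one, so finiteness is secured first; it
   follows from [empirical_df_le1]. *)
have fin : (\int[mu]_y (K y * empirical_df n x (t - h * y))%:E)%E \is a fin_num.
  rewrite ge0_fin_numE; last by apply: integral_ge0 => y _; rewrite lee_fin mulr_ge0// empirical_df_ge0.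
  apply: (@le_lt_trans _ _ (\int[mu]_x (K x)%:E)%E); last by rewrite K1 ltry.
  apply: ge0_le_integral => //.
  - by move=> y _; rewrite lee_fin mulr_ge0// empirical_df_ge0.
  - by apply/measurable_EFinP; exact: measurable_funM.
  - exact/measurable_EFinP.
  - by move=> y _; rewrite lee_fin ler_piMr// empirical_df_le1.
rewrite /kernel_df /Rintegral -(fineK fin); congr (fine _)%:E.
pose g i y := (K y * (x i <= t - h * y)%R%:R).
have mg i : measurable_fun setT (g i).
  apply: measurable_funM => //.
  rewrite (_ : (fun y : R => _) = (fun y : R => if x i <= t - h * y then 1 else 0)); last first.
    by apply/funext => y; case: ifP.
  apply: measurable_fun_ifT => //; apply: measurable_fun_ler => //.
  by apply: measurable_funB => //; exact: measurable_funM.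
have g0 i y : 0 <= g i y by rewrite mulr_ge0.
transitivity (\sum_(i < n) (n%:R^-1%:E * \int[mu]_y (g i y)%:E))%E.
  rewrite -ge0_sume_distrr; last by move=> i _; apply: integral_ge0 => y _; rewrite lee_fin.
  rewrite -ge0_integral_sum//; last 2 first.
  - by move=> i; apply/measurable_EFinP; exact: mg.
  - by move=> i y _; rewrite lee_fin.
  rewrite -ge0_integralZl_EFin//; last 2 first.
  - by move=> y _; apply: sume_ge0 => i _; rewrite lee_fin.
  - by apply: emeasurable_sum => i; apply/measurable_EFinP; exact: mg.
  apply: eq_integral => y _; rewrite sumEFin -EFinM; congr EFin.
  by rewrite /empirical_df mulrCA -mulr_sumr.
rewrite integral_mkcond.
rewrite (_ : (\int[mu]_u _)%E = (\int[mu]_u \sum_(i < n)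
  ((n%:R * h)^-1%:E * (g i (h^-1 * u + - (x i / h)))%:E))%E); last first.
  apply: eq_integral => u _; rewrite patchE; under [RHS]eq_bigr do rewrite -EFinM.
  rewrite sumEFin /g -mulr_sumr /kde.
  have Ei (i : 'I_n) : (x i <= t - h * (h^-1 * u + - (x i / h))) = (u <= t).
    have -> : t - h * (h^-1 * u + - (x i / h)) = t - u + x i by field; rewrite gt_eqF.
    by rewrite lerDr subr_ge0.
  under [X in _ = (_ * X)%:E]eq_bigr do rewrite Ei.
  case: ifPn => ut.
    rewrite (_ : u <= t); last by move: ut; rewrite inE /= in_itv.
    congr (_ * _)%:E; apply: eq_bigr => i _; rewrite mulr1; congr K; field.
    by rewrite gt_eqF.
  rewrite (_ : (u <= t) = false); last by apply/negbTE; apply: contra ut; rewrite inE /= in_itv.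
  by rewrite big1 ?mulr0// => i _; rewrite mulr0.
have mg' (i : 'I_n) : measurable_fun setT (fun u => (g i (h^-1 * u + - (x i / h)))%:E).
  apply/measurable_EFinP; apply: measurableT_comp => //.
  by apply: measurable_funD => //; exact: measurable_funM.
rewrite ge0_integral_sum//; last 2 first.
- by move=> i; apply: emeasurable_funM; [exact: measurable_cst|exact: mg'].
- by move=> i u _; rewrite -EFinM lee_fin mulr_ge0// invr_ge0 mulr_ge0// ltW.
apply: eq_bigr => i _.
rewrite ge0_integralZl_EFin//; last 3 first.
- by move=> u _; rewrite lee_fin.
- exact: mg'.
- by rewrite invr_ge0 mulr_ge0// ltW.
rewrite (@ge0_integral_affine R h^-1 (- (x i / h)) (fun y => (g i y)%:E))//; last 3 first.
- by rewrite invr_eq0 gt_eqF.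
- exact/measurable_EFinP.
- by move=> y; rewrite lee_fin.
rewrite muleA -EFinM; congr (_%:E * _)%E.
by rewrite normrV ?unitfE ?gt_eqF// invrK gtr0_norm//; field; rewrite !gt_eqF.
Qed.



Lemma empirical_dfB n (x : nat -> R) a b : a <= b ->
  empirical_df n x b - empirical_df n x a = n%:R^-1 * \sum_(i < n) (a < x i <= b)%R%:R.
Proof.
move=> ab; rewrite /empirical_df -mulrBr -sumrB; congr (_ * _); apply: eq_bigr => i _.
have [xa|xa] := leP (x i) a; first by rewrite (le_trans xa ab) subrr.
by rewrite subr0.
Qed.

Lemma empirical_df_nd n (x : nat -> R) a b : a <= b -> empirical_df n x a <= empirical_df n x b.
Proof. by move=> ab; rewrite -subr_ge0 empirical_dfB// mulr_ge0 ?invr_ge0// sumr_ge0. Qed.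

(** For [x i] in []a, b]], [|x i| / del] is within [r] of [|b| / del], so its integer part takes at
    most [2 r + 2] values, each shared by at most [M] observations. *)
Lemma empirical_df_osc n (x : nat -> R) (del M r : R) : 0 < del -> 0 <= r -> 0 <= M ->
  (forall k, \sum_(i < n) (Num.truncn (`|x i| / del) == k)%:R <= M) ->
  forall a b, a <= b -> b - a <= del * r ->
  empirical_df n x b - empirical_df n x a <= n%:R^-1 * (M * (2 * r + 2)).
Proof.
move=> del0 r0 M0 HM a b ab bar; rewrite empirical_dfB// ler_wpM2l ?invr_ge0//.
pose be := `|b| / del.
have be0 : 0 <= be by rewrite divr_ge0// ltW.
pose k0 := Num.truncn (be - r). pose k1 := Num.truncn (be + r).
apply: (@le_trans _ _ (\sum_(i < n) \sum_(k0 <= k < k1.+1) (Num.truncn (`|x i| / del) == k)%:R)).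
  apply: ler_sum => i _; case: (boolP (a < x i <= b)) => [/andP[ax xb]|_]; last by rewrite sumr_ge0.
  have h1 : `|x i| <= `|b| + del * r.
    rewrite -[x i](subrK b) addrC (le_trans (ler_normD _ _))// lerD2l.
    by rewrite ler_norml; apply/andP; split; lra.
  have h2 : `|b| - del * r <= `|x i|.
    rewrite lerBlDr -[b in `|b|](subrK (x i)) addrC (le_trans (ler_normD _ _))// lerD2l.
    by rewrite ler_norml; apply/andP; split; lra.
  have g1 : `|x i| / del <= be + r.
    by rewrite ler_pdivrMr// mulrDl /be divfK ?gt_eqF// [r * _]mulrC.
  have g2 : be - r <= `|x i| / del.
    by rewrite ler_pdivlMr// mulrBl /be divfK ?gt_eqF// [r * _]mulrC.
  have kin : Num.truncn (`|x i| / del) \in index_iota k0 k1.+1.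
    by rewrite mem_index_iota ltnS !le_truncn.
  by rewrite (big_rem _ kin)/= eqxx lerDl sumr_ge0.
rewrite exchange_big/=.
apply: (@le_trans _ _ (\sum_(k0 <= k < k1.+1) M)).
  by apply: ler_sum => k _.
rewrite sumr_const_nat -[leLHS]mulr_natl mulrC ler_wpM2l//.
have k01 : (k0 <= k1.+1)%N by rewrite leqW// le_truncn// lerD2l; lra.
rewrite natrB//.
have tr1 : k1%:R <= be + r by rewrite truncn_le// addr_ge0.
have tr0 : be - r < k0.+1%:R by exact: truncnS_gt.
by move: tr0; rewrite -!natr1; lra.
Qed.

(** Shifting by [h y] with [h <= del] changes the empirical distribution function by at most
    [M (2 |y| + 2) / n]; the [K]-average of this bound involves the first absolute moment [aK]. *)
Lemma kernel_df_near (aK : R) n h (x : nat -> R) t (del M : R) :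
  (\int[mu]_y (`|y| * K y)%:E = aK%:E)%E -> (0 < n)%N -> 0 < h -> h <= del -> 0 <= M ->
  (forall k, \sum_(i < n) (Num.truncn (`|x i| / del) == k)%:R <= M) ->
  `|empirical_df n x t - kernel_df K n h x t| <= n%:R^-1 * M * (2 * aK + 2).
Proof.
move=> aKE n0 h0 hd M0 HM.
have del0 : 0 < del by exact: lt_le_trans hd.
have mt := measurable_empirical_df n x t h.
have c0 : 0 <= n%:R^-1 * M by rewrite mulr_ge0 ?invr_ge0.
have osc y : `|empirical_df n x t - empirical_df n x (t - h * y)| <= n%:R^-1 * M * (2 * `|y| + 2).
  have [y0|/ltW y0] := leP 0 y.
    have hy : t - h * y <= t by rewrite gerBl mulr_ge0// ltW.
    rewrite ger0_norm ?subr_ge0 ?empirical_df_nd// -mulrA ger0_norm//.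
    apply: (empirical_df_osc del0 y0 M0 HM hy).
    by rewrite opprB addrC subrK ler_wpM2r.
  have hy : t <= t - h * y by rewrite lerBrDr gerDl mulr_ge0_le0// ltW.
  rewrite distrC ger0_norm ?subr_ge0 ?empirical_df_nd// -mulrA ler0_norm//.
  have y0' : 0 <= - y by rewrite oppr_ge0.
  apply: (empirical_df_osc del0 y0' M0 HM hy).
  by rewrite addrAC subrr add0r -mulrN ler_wpM2r// oppr_ge0.
have mKy : measurable_fun setT (fun y : R => K y * (n%:R^-1 * M * (2 * `|y| + 2))).
  apply: measurable_funM => //; apply: measurable_funM => //; apply: measurable_funD => //.
  by apply: measurable_funM => //; exact: normr_measurable.
have IC : (\int[mu]_y (K y * (n%:R^-1 * M * (2 * `|y| + 2)))%:E = (n%:R^-1 * M * (2 * aK + 2))%:E)%E.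
  transitivity (\int[mu]_y ((n%:R^-1 * M * 2)%:E * (`|y| * K y)%:E + (n%:R^-1 * M * 2)%:E * (K y)%:E))%E.
    by apply: eq_integral => y _; rewrite -!EFinM -EFinD; congr EFin; ring.
  have c1 : 0 <= n%:R^-1 * M * 2 by rewrite mulr_ge0.
  have myK : measurable_fun setT (fun y : R => (`|y| * K y)%:E).
    by apply/measurable_EFinP; apply: measurable_funM => //; exact: normr_measurable.
  rewrite ge0_integralD//; last 4 first.
  - by move=> y _; rewrite -EFinM lee_fin !mulr_ge0.
  - by apply: emeasurable_funM => //; exact: measurable_cst.
  - by move=> y _; rewrite -EFinM lee_fin !mulr_ge0.
  - by apply: emeasurable_funM => //; exact/measurable_EFinP.
  rewrite !ge0_integralZl_EFin//; last 3 first.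
  - by move=> y _; rewrite lee_fin.
  - exact/measurable_EFinP.
  - by move=> y _; rewrite lee_fin mulr_ge0.
  rewrite aKE K1 mule1 -EFinM -EFinD; congr EFin; ring.
have IF (s : R) : 0 <= s -> (\int[mu]_y (K y * s)%:E = s%:E)%E.
  move=> s0; under eq_integral do rewrite mulrC EFinM.
  rewrite ge0_integralZl_EFin//; last 2 first.
  - by move=> y _; rewrite lee_fin.
  - exact/measurable_EFinP.
  by rewrite K1 mule1.
have mKs (s : R) : measurable_fun setT (fun y : R => K y * s) by exact: measurable_funM.
have mKt : measurable_fun setT (fun y : R => K y * empirical_df n x (t - h * y)) by exact: measurable_funM.
have t0 := empirical_df_ge0 n x t.
have cC0 y : 0 <= n%:R^-1 * M * (2 * `|y| + 2) by rewrite mulr_ge0// addr_ge0// mulr_ge0.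
rewrite ler_norml; apply/andP; split.
  rewrite lerNl opprB lerBlDl -lee_fin EFinD -(kernel_dfE _ _ n0 h0) -(IF _ t0) -IC.
  rewrite -ge0_integralD//; last 4 first.
  - by move=> y _; rewrite lee_fin mulr_ge0.
  - first [exact/measurable_EFinP|apply/measurable_EFinP; exact: mKs].
  - by move=> y _; rewrite lee_fin mulr_ge0.
  - first [exact/measurable_EFinP|apply/measurable_EFinP; exact: mKs].
  apply: ge0_le_integral => //.
  - by move=> y _; rewrite lee_fin mulr_ge0// empirical_df_ge0.
  - first [exact/measurable_EFinP|apply/measurable_EFinP; exact: mKs].
  - by apply: emeasurable_funD; first [exact/measurable_EFinP|apply/measurable_EFinP; exact: mKs].
  move=> y _; rewrite -EFinD lee_fin -mulrDr ler_wpM2l//.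
  by have := osc y; rewrite ler_norml => /andP[]; lra.
rewrite lerBlDl -lee_fin EFinD -(kernel_dfE _ _ n0 h0) -(IF _ t0) -IC.
rewrite -ge0_integralD//; last 4 first.
- by move=> y _; rewrite lee_fin mulr_ge0// empirical_df_ge0.
- first [exact/measurable_EFinP|apply/measurable_EFinP; exact: mKs].
- by move=> y _; rewrite lee_fin mulr_ge0.
- first [exact/measurable_EFinP|apply/measurable_EFinP; exact: mKs].
apply: ge0_le_integral => //.
- by move=> y _; rewrite lee_fin mulr_ge0.
- first [exact/measurable_EFinP|apply/measurable_EFinP; exact: mKs].
- by apply: emeasurable_funD; first [exact/measurable_EFinP|apply/measurable_EFinP; exact: mKs].
move=> y _; rewrite -EFinD lee_fin -mulrDr ler_wpM2l//.
by have := osc y; rewrite ler_norml => /andP[]; lra.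
Qed.

End kernel_df_lemmas.

(** * Exclusion of large bandwidths *)

Section bandwidth_lower.
Context {R : realType}.
Local Notation mu := (@lebesgue_measure R).

(** Starting points at least [L] apart make the intervals []y j, y j + L]] disjoint, so each
    observation is counted at most once. *)
Lemma sum_disjoint_increments n (x y : nat -> R) (L : R) J : (0 < n)%N -> 0 < L ->
  (forall j k, (j < k < J)%N -> L <= `|y j - y k|) ->
  \sum_(j < J) (empirical_df n x (y j + L) - empirical_df n x (y j)) <= 1.
Proof.
move=> n0 L0 Hy.
under eq_bigr do rewrite empirical_dfB ?lerDl ?ltW//.
rewrite -mulr_sumr ler_pdivrMl ?ltr0n// mulr1 exchange_big/=.
rewrite -[X in _ <= X%:R]card_ord -sum1_card natr_sum; apply: ler_sum => i _.
have [/existsP[j /= hj]|/existsPn h] := boolP [exists j : 'I_J, y j < x i <= y j + L]; last first.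
  by rewrite big1 // => j _; rewrite (negbTE (h j)).
rewrite (bigD1 j)//= hj big1 ?addr0// => k kj.
have Ljk : L <= `|y j - y k|.
  have [jk|jk|/val_inj jk] := ltngtP j k; last by rewrite jk eqxx in kj.
    by apply: Hy; rewrite jk ltn_ord.
  by rewrite distrC; apply: Hy; rewrite jk ltn_ord.
case: (boolP (_ < _ <= _)) => // hk; exfalso.
move: hj hk => /andP[h1 h2] /andP[h3 h4].
by move: Ljk; rewrite ler_normr => /orP[]; lra.
Qed.

Lemma empirical_df_cover n (x : nat -> R) (L U a : R) N :
  (forall t, empirical_df n x (t + L) - empirical_df n x t <= U) ->
  empirical_df n x (a + N%:R * L) - empirical_df n x a <= N%:R * U.
Proof.
move=> HU; elim: N => [|N IH]; first by rewrite !mul0r addr0 subrr.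
have := HU (a + N%:R * L); rewrite -!natr1 !mulrDl !mul1r addrA; lra.
Qed.

(** A density has no atom at 0: without such [a] and [sg], dominated convergence as [a] decreases to
    0 would give total mass 0. Fixing one side [sg] later makes the chain of shifts monotone, so
    that its intervals never meet again. *)
Lemma density_mass_away (K : R -> R) : probability_density K ->
  exists a (sg : bool) (q : R), [/\ 0 < a, 0 < q, q <= 1 &
    (\int[mu]_y (if (a <= (-1) ^+ sg * y)%R then K y else 0)%:E = q%:E)%E].
Proof.
move=> [mK K0 K1].
pose g a (sg : bool) (y : R) := if a <= (-1) ^+ sg * y then K y else 0.
have mg a sg : measurable_fun setT (g a sg).
  apply: (@measurable_fun_ifT _ _ _ _ K (cst 0)) => //; apply: measurable_fun_ler.
    exact: measurable_cst.
  by apply: measurable_funM => //; exact: measurable_cst.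
have g0 a sg y : 0 <= g a sg y by rewrite /g; case: ifP.
have gK a sg y : g a sg y <= K y by rewrite /g; case: ifP.
have gle a sg : (\int[mu]_y (g a sg y)%:E <= 1)%E.
  rewrite -K1; apply: ge0_le_integral => //.
  - by move=> y _; rewrite lee_fin.
  - by apply/measurable_EFinP; exact: mg.
  - exact/measurable_EFinP.
  - by move=> y _; rewrite lee_fin.
have gfin a sg : (\int[mu]_y (g a sg y)%:E)%E \is a fin_num.
  rewrite ge0_fin_numE; first exact: le_lt_trans (gle a sg) (ltry _).
  by apply: integral_ge0 => y _; rewrite lee_fin.
apply: contrapT => H.
have Z a sg : 0 < a -> (\int[mu]_y (g a sg y)%:E = 0)%E.
  move=> a0; apply: contrapT => /eqP nz; apply: H.
  exists a, sg, (fine (\int[mu]_y (g a sg y)%:E)); split => //.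
  - rewrite lt_neqAle eq_sym fine_eq0// nz/= fine_ge0//.
    by apply: integral_ge0 => y _; rewrite lee_fin.
  - by rewrite -lee_fin fineK.
  - by rewrite fineK.
pose v n := n.+1%:R^-1 : R.
have v0 n : 0 < v n by rewrite invr_gt0.
have lim : (\int[mu]_y (g (v n) false y + g (v n) true y)%:E)%E @[n --> \oo]
    --> (\int[mu]_y (if (y == 0)%R then 0 else K y)%:E)%E.
  have iK : mu.-integrable setT (EFin \o K).
    exact: (density_integrable (K := K)).
  apply: (@dominated_cvg _ _ R mu setT measurableT _ _ (fun y => (K y)%:E)) => //=.
  - by move=> n; apply/measurable_EFinP; apply: measurable_funD; exact: mg.
  - move=> y _; apply: cvg_near_cst.
    have [->|y0] := eqVneq y 0.
      near=> n; rewrite /g !mulr0 !ifF ?addr0//; apply/negbTE; rewrite -ltNge; exact: v0.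
    have yn0 : 0 < `|y| by rewrite normr_gt0.
    near=> n.
    have vn : v n < `|y| by near: n; exact: (near_infty_natSinv_lt (PosNum yn0)).
    have := v0 n; rewrite /g expr0 expr1 mul1r mulN1r => vp.
    have [yp|yp] := ltP 0 y.
      rewrite gtr0_norm// in vn; rewrite (ltW vn) (_ : (v n <= - y) = false) ?addr0//.
      by apply/negbTE; rewrite -ltNge; lra.
    rewrite ler0_norm// in vn; rewrite (ltW vn) (_ : (v n <= y) = false) ?add0r//.
    by apply/negbTE; rewrite -ltNge; lra.
  - move=> n y _; rewrite lee_fin ger0_norm ?addr_ge0// /g.
    have := v0 n; rewrite expr0 expr1 mul1r mulN1r => vp.
    case: ifP => h1; case: ifP => h2; rewrite ?addr0 ?add0r//; lra.
have z0 n : (\int[mu]_y (g (v n) false y + g (v n) true y)%:E = 0)%E.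
  under eq_integral do rewrite EFinD.
  rewrite ge0_integralD//; last 4 first.
  - by move=> y _; rewrite lee_fin.
  - by apply/measurable_EFinP; exact: mg.
  - by move=> y _; rewrite lee_fin.
  - by apply/measurable_EFinP; exact: mg.
  by rewrite !Z ?adde0.
have : (\int[mu]_y (if (y == 0)%R then 0 else K y)%:E = 1)%E.
  rewrite -K1 -[RHS](@integral_setD1 _ _ 0 setT).
  - rewrite [RHS]integral_mkcond; apply: eq_integral => y _; rewrite patchE.
    case: eqP => [->|y0].
      by rewrite (_ : (0 \in _) = false)//; apply/negbTE/negP => /set_mem [_ /(_ erefl)].
    by rewrite ifT//; apply/mem_set; split.
  - exact: measurableD.
  - by apply: measurable_funTS; exact/measurable_EFinP.
move=> E1; rewrite E1 in lim.
have c0 : (\int[mu]_y (g (v n) false y + g (v n) true y)%:E)%E @[n --> \oo] --> (0 : \bar R).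
  by rewrite (_ : (fun n => _) = cst 0%E); [exact: cvg_cst|apply/funext => n; rewrite z0].
suff : (1%E : \bar R) = 0%E by move/eqP; rewrite onee_eq0.
by rewrite -(cvg_lim (@ereal_hausdorff R) lim); apply: cvg_lim; [exact: ereal_hausdorff|exact: c0].
Unshelve. all: by end_near. Qed.


Section chain.
Variable K : R -> R.
Hypothesis K_density : probability_density K.

(* Maximum principle: an increment of [kernel_df] is the K-average of the increments
   of [empirical_df] over the shifts h * y. *)
Lemma chain_step n (h : R) (x : nat -> R) (L U a q s tau t : R) (sg : bool) :
  (0 < n)%N -> 0 < h -> 0 <= L -> 0 < q -> 0 < s ->
  (forall t, empirical_df n x (t + L) - empirical_df n x t <= U) ->
  (\int[mu]_y (if (a <= (-1) ^+ sg * y)%R then K y else 0)%:E = q%:E)%E ->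
  `|(empirical_df n x (t + L) - empirical_df n x t) -
    (kernel_df K n h x (t + L) - kernel_df K n h x t)| <= 2 * s ->
  U - tau <= empirical_df n x (t + L) - empirical_df n x t -> 0 <= tau ->
  exists2 y, a <= (-1) ^+ sg * y &
    U - (tau + 3 * s) / q <= empirical_df n x (t - h * y + L) - empirical_df n x (t - h * y).
Proof.
move=> n0 h0 L0 q0 s0 HU qE near_t tau_t tau0.
have [mK K0 K1] := K_density.
apply: contrapT => /forall2NP H.
set c := (tau + 3 * s) / q.
have c0 : 0 <= c by rewrite divr_ge0 ?addr_ge0 ?mulr_ge0// ltW.
pose u t := empirical_df n x (t + L) - empirical_df n x t.
have U0 : 0 <= U by apply: le_trans (HU 0); rewrite subr_ge0 empirical_df_nd// lerDl.
have mu_ (f : R -> R) : measurable_fun setT f -> measurable_fun setT (fun y => K y * f y).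
  by move=> ?; exact: measurable_funM.
have mE1 := measurable_empirical_df n x t h.
have mE2 := measurable_empirical_df n x (t + L) h.
have uE y : u (t - h * y) = empirical_df n x (t + L - h * y) - empirical_df n x (t - h * y).
  by rewrite /u addrAC.
have mUu : measurable_fun setT (fun y : R => U - u (t - h * y)).
  apply: measurable_funB => //.
  rewrite (_ : (fun y : R => u _) =
    (fun y => empirical_df n x (t + L - h * y) - empirical_df n x (t - h * y))).
    exact: measurable_funB.
  by apply/funext => y; exact: uE.
have KU0 y : 0 <= K y * (U - u (t - h * y)) by rewrite mulr_ge0// subr_ge0 HU.
(* If all increments on that side were below [U - c], the [K]-averaged deficit to [U] would be at
   least [c q = tau + 3 s]. By [I2] and [near_t] it is at most [tau + 2 s]; the third [s] makes the
   contradiction strict. *)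
have I1 : ((tau + 3 * s)%:E <= \int[mu]_y (K y * (U - u (t - h * y)))%:E)%E.
  rewrite (_ : tau + 3 * s = c * q); last by rewrite /c divfK// gt_eqF.
  have mg : measurable_fun setT (fun y : R => if a <= (-1) ^+ sg * y then K y else 0).
    apply: (@measurable_fun_ifT _ _ _ _ K (cst 0)) => //; apply: measurable_fun_ler.
      exact: measurable_cst.
    by apply: measurable_funM => //; exact: measurable_cst.
  rewrite EFinM -qE -ge0_integralZl_EFin//; last 2 first.
  - by move=> y _; rewrite lee_fin; case: ifP.
  - exact/measurable_EFinP.
  apply: ge0_le_integral => //.
  - by move=> y _; rewrite -EFinM lee_fin mulr_ge0//; case: ifP.
  - by apply: emeasurable_funM => //; exact/measurable_EFinP.
  - by apply/measurable_EFinP; exact: mu_.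
  move=> y _; rewrite -EFinM lee_fin; case: ifP => ay; last by rewrite mulr0.
  rewrite mulrC ler_wpM2l//.
  have [/(_ ay)//|/negP] := H y.
  by rewrite -ltNge -/(u (t - h * y)) -/c; lra.
have I2 : (\int[mu]_y (K y * (U - u (t - h * y)))%:E + (kernel_df K n h x (t + L))%:E =
    U%:E + (kernel_df K n h x t)%:E)%E.
  have KU : (\int[mu]_y (K y * U)%:E = U%:E)%E.
    under eq_integral do rewrite mulrC EFinM.
    rewrite ge0_integralZl_EFin//; last 2 first.
    - by move=> y _; rewrite lee_fin.
    - exact/measurable_EFinP.
    by rewrite K1 mule1.
  rewrite -!(kernel_dfE K_density)// -KU -!ge0_integralD//; last first.
  - by apply/measurable_EFinP; exact: mu_.
  - by move=> y _; rewrite lee_fin mulr_ge0// empirical_df_ge0.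
  - by apply/measurable_EFinP; exact: mu_.
  - by move=> y _; rewrite lee_fin.
  - by apply/measurable_EFinP; exact: mu_.
  - by move=> y _; rewrite lee_fin mulr_ge0// empirical_df_ge0.
  - by apply/measurable_EFinP; apply: mu_; exact: measurable_cst.
  - by move=> y _; rewrite lee_fin mulr_ge0.
  apply: eq_integral => y _; rewrite -!EFinD uE; congr EFin; ring.
have := leeD I1 (lexx (kernel_df K n h x (t + L))%:E).
rewrite I2 -!EFinD lee_fin.
by move: near_t; rewrite ler_norml => /andP[]; lra.
Qed.

(* Iterating [chain_step] 4N times, where N intervals of length L cover ]-M, M],
   produces disjoint intervals of total mass > 1. *)
Lemma large_bandwidth_far (eta M : R) : 0 < eta -> 0 <= M ->
  exists2 s0, 0 < s0 & forall n (x : nat -> R) h s, (0 < n)%N -> eta <= h -> 0 < s -> s <= s0 ->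
    2^-1 <= empirical_df n x M - empirical_df n x (- M) ->
    (forall a b, a <= b -> `|(empirical_df n x b - empirical_df n x a) -
      (kernel_df K n h x b - kernel_df K n h x a)| <= 2 * s) -> False.
Proof.
move=> eta0 M0.
have [a [sg [q [a0 q0 q1 qE]]]] := density_mass_away K_density.
(* A shift by [h y] on the chosen side has length at least [h a >= eta a = L], which makes
   successive intervals disjoint. *)
pose L := eta * a; have L0 : 0 < L by rewrite mulr_gt0.
pose N := (Num.truncn (2 * M / L)).+1.
have NL : 2 * M <= N%:R * L.
  by rewrite -ler_pdivrMr// ltW//; exact: truncnS_gt.
pose J := (4 * N)%N.
(* Losses in units of [s]: the supremum is first approached within [s], then [chain_step] turns a
   loss [z s] into [(z + 3) s / q]. As [c] does not depend on [n], a fixed [s0] keeps the total loss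
   [D * s] at most 1/2. *)
pose c j := iter j (fun z => (z + 3) / q) (1 : R).
have c1 j : 0 < c j.
  by elim: j => [|j IH]; [exact: ltr01|apply: divr_gt0 => //; apply: addr_gt0].
pose D := \sum_(j < J) c j.
have J0 : (0 < J)%N by [].
have D0 : 0 < D.
  by rewrite /D (bigD1 (Ordinal J0))//= ltr_pwDl ?sumr_ge0// => j _; exact: ltW (c1 _).
exists (2 * D)^-1; first by rewrite invr_gt0 mulr_gt0.
move=> n x h s n0 eh s0 sD half near_d.
have h0 : 0 < h by exact: lt_le_trans eh.
pose u t := empirical_df n x (t + L) - empirical_df n x t.
have hs : has_sup (range u).
  split; first by exists (u 0), 0.
  exists 1 => _ [t _ <-]; rewrite /u.
  by have := empirical_df_ge0 n x t; have := empirical_df_le1 n x (t + L); lra.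
pose U := sup (range u).
have HU t : u t <= U by apply: sup_ubound; [exact: hs.2|exists t].
have [_ [t0 _ <-] ht0] := sup_adherent s0 hs.
have NU : 2^-1 <= N%:R * U.
  apply: (le_trans half); apply: le_trans (empirical_df_cover (- M) N HU).
  by rewrite lerD2r empirical_df_nd//; lra.
(* The hypothesis sits under the existential, with the dummy point 0 when it fails, so that [choice]
   yields a total map to iterate. *)
have step (p : nat * R) : exists t', U - c p.1 * s <= u p.2 ->
    L <= (-1) ^+ sg * (p.2 - t') /\ U - c p.1.+1 * s <= u t'.
  have [hp|hp] := pselect (U - c p.1 * s <= u p.2); last by exists 0.
  have pL : p.2 <= p.2 + L by rewrite lerDl ltW.
  have [y ay hy] := chain_step n0 h0 (ltW L0) q0 s0 HU qE (near_d _ _ pL) hp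
    (mulr_ge0 (ltW (c1 _)) (ltW s0)).
  exists (p.2 - h * y) => _; split.
    rewrite opprB addrC subrK mulrCA.
    apply: (@le_trans _ _ (h * a)); last by rewrite ler_wpM2l// ltW.
    by rewrite ler_wpM2r// ltW.
  rewrite (_ : c p.1.+1 * s = (c p.1 * s + 3 * s) / q)//.
  by rewrite /c/=; field; rewrite gt_eqF.
have [nx Hnx] := choice step.
pose y := fix y j := if j is j'.+1 then nx (j', y j') else t0.
have uy j : U - c j * s <= u (y j).
  elim: j => [|j IH]; first by rewrite /c/= mul1r ltW.
  exact: (Hnx (j, y j) IH).2.
have yS j : L <= (-1) ^+ sg * (y j - y j.+1) by exact: (Hnx (j, y j) (uy j)).1.
have yjk j k : (j < k)%N -> L <= (-1) ^+ sg * (y j - y k).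
  elim: k => // k IH; rewrite ltnS leq_eqVlt => /orP[/eqP ->//|/IH jk].
  rewrite (_ : y j - y k.+1 = (y j - y k) + (y k - y k.+1)); last ring.
  by rewrite mulrDr; have := yS k; lra.
have yabs j k : (j < k < J)%N -> L <= `|y j - y k|.
  move=> /andP[jk _]; apply: (le_trans (yjk _ _ jk)).
  by rewrite (le_trans (ler_norm _))// normrM normrX normrN1 expr1n mul1r.
have := sum_disjoint_increments x n0 L0 yabs.
apply/negP; rewrite -ltNge.
apply: (@lt_le_trans _ _ (\sum_(j < J) (U - c j * s))); last by apply: ler_sum => j _; exact: uy.
(* [4 N U - D s >= 2 - 1/2 > 1], because [N U >= 1/2]. *)
rewrite sumrB sumr_const card_ord -mulr_suml -/D -[X in X - _]mulr_natl /J natrM.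
have : D * s <= 2^-1.
  apply: (@le_trans _ _ (D * (2 * D)^-1)); first by rewrite ler_wpM2l// ltW.
  by rewrite invfM mulrCA divff ?mulr1// gt_eqF.
by lra.
Qed.

End chain.

End bandwidth_lower.

Section assembly.
Context {disp : measure_display} {T : measurableType disp} {R : realType} (P : probability T R).
Local Notation mu := (@lebesgue_measure R).
Variables (X : nat -> {RV P >-> R}) (X_iid : iid X) (f : R -> R) (X_density : has_density (X 0%N) f).

Lemma measurable_abs_ge (r : R) : measurable [set y : R | r <= `|y|].
Proof.
rewrite -[X in measurable X]setTI.
have mb : measurable_fun setT (fun y : R => r <= `|y|).
  by apply: measurable_fun_ler => //; exact: normr_measurable.
exact: (mb measurableT [set true]).
Qed.

(** The successor makes the cut point positive. *)
Lemma has_density_tail e : 0 < e -> exists N : nat,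
  fine (distribution P (X 0%N) [set y : R | N.+1%:R <= `|y|]) <= e.
Proof.
move=> e0; have [fd fX] := X_density; have [mf f0 f1] := fd.
have [N HN] := integrable_tail (density_integrable fd) e0.
exists N; rewrite -lee_fin fineK ?fin_num_measure//; last exact: measurable_abs_ge.
apply: (@le_trans _ _ (distribution P (X 0%N) [set y : R | N%:R <= `|y|])).
  apply: le_measure; [by rewrite inE; exact: measurable_abs_ge..|].
  by move=> y /=; apply: le_trans; rewrite ler_nat.
rewrite fX; last exact: measurable_abs_ge.
 apply: le_trans HN; rewrite integral_mkcond.
rewrite le_eqVlt; apply/orP; left; apply/eqP; apply: eq_integral => y _.
rewrite patchE; case: ifPn => [/set_mem/= ->|]; first by rewrite ger0_norm.
by move=> /negP yN; rewrite ifF//; apply/negbTE/negP => h; apply: yN; exact/mem_set.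
Qed.

Lemma sample_freqE (I : finType) (c : R -> I) n w j :
  (freq (sample_cells X c n w) j : R) = n%:R^-1 * \sum_(i < n) (c (X i w) == j)%:R.
Proof. by rewrite /freq; congr (_ * _); apply: eq_bigr => i _; rewrite ffunE. Qed.

(** Two cells suffice: []- M, M]] has probability at least 3/4, and its frequency is eventually
    within 1/4 of that probability. *)
Lemma mass_eventually : exists2 M : R, 0 <= M & {ae P, forall w, \forall n \near \oo,
  2^-1 <= empirical_df n (X ^~ w) M - empirical_df n (X ^~ w) (- M)}.
Proof.
have q4 : (0 : R) < 4^-1 by rewrite invr_gt0.
have [N HN] := has_density_tail q4.
have M0 : (0 : R) < N.+1%:R by [].
exists N.+1%:R => //; set M : R := N.+1%:R in HN M0 *.
pose Q (y : R) := - M < y <= M.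
pose c (y : R) : 'I_2 := inord (if Q y then 0%N else 1%N).
have mc j : measurable (c @^-1` [set j]).
  apply: (@measurable_if_cell R 1 Q (fun=> 0%N) 1%N j); last exact: measurable_cst.
  apply: measurable_and; first exact: measurable_fun_ltr.
  exact: measurable_fun_ler.
have c0E y : (c y == ord0) = Q y.
  by rewrite /c -val_eqE /=; case: (Q y); rewrite inordK.
have p0 : 3 / 4 <= cell_prob X c ord0.
  rewrite /cell_prob.
  have mS := mc ord0.
  have -> : c @^-1` [set ord0] = ~` (~` (c @^-1` [set ord0])) by rewrite setCK.
  rewrite probability_setC; last exact: measurableC.
  rewrite fineB ?fin_num_measure//=; last exact: measurableC.
  suff : fine (distribution P (X 0%N) (~` (c @^-1` [set ord0]))) <= 4^-1 by lra.
  apply: le_trans HN; apply: fine_le; rewrite ?fin_num_measure//.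
  - exact: measurableC.
  - exact: measurable_abs_ge.
  apply: le_measure; [by rewrite inE; exact: measurableC|by rewrite inE; exact: measurable_abs_ge|].
  move=> y /= /eqP; rewrite c0E /Q negb_and -leNgt -ltNge ler_normr => /orP[] ?; apply/orP; lra.
have H : {ae P, forall w, \forall n \near \oo, freq_dev (cell_prob X c) (sample_cells X c n w) <= 4^-1}.
  apply: (@freq_dev_eventually _ T R P X X_iid (fun=> 1%N) (fun=> c) 4^-1 2) => //; first lra.
  by near=> n; rewrite lerDr divr_ge0// mulr_ge0// exprn_ge0// invr_ge0.
move: H; apply: filterS => w Hw; near=> n.
have Hn : freq_dev (cell_prob X c) (sample_cells X c n w) <= 4^-1 by near: n; exact: Hw.
have n0 : (0 < n)%N by near: n; exact: nbhs_infty_gt.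
rewrite empirical_dfB; last by rewrite ge0_cp// ltW.
under eq_bigr do rewrite -/(Q _) -c0E.
rewrite -(sample_freqE c).
have : `|freq (sample_cells X c n w) ord0 - cell_prob X c ord0| <= 4^-1.
  by apply: le_trans Hn; rewrite /freq_dev (bigD1 ord0)//= lerDl sumr_ge0.
by rewrite ler_norml => /andP[]; lra.
Unshelve. all: by end_near. Qed.

End assembly.

(** * Almost sure limits of the chosen bandwidth *)

Section bandwidth_limits.
Context {disp : measure_display} {T : measurableType disp} {R : realType} (P : probability T R).
Local Notation mu := (@lebesgue_measure R).
Variables (l : nat) (K : R -> R) (K_kernel : kernel_of_order l K) (K_density : probability_density K).
Variables (X : nat -> {RV P >-> R}) (X_iid : iid X) (f : R -> R) (X_density : has_density (X 0%N) f).
Variables (k : nat) (d : (R -> R) -> (R -> R) -> \bar R) (d_like : distance_like k d) (k1 : (1 <= k)%N).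
Variables (s : nat -> R) (s_gt0 : forall n, (1 <= n)%N -> 0 < s n).
Variables (h : nat -> {RV P >-> R}) (h_gt0 : forall n w, (1 <= n)%N -> 0 < h n w).
Hypothesis h_solution : {ae P, forall w, \forall n \near \oo,
  d (empirical_df n (X ^~ w)) (kernel_df K n (h n w) (X ^~ w)) = (s n)%:E}.

(** A distance [s n] forces the increments of the two distribution functions to agree within
    [2 s n], which [large_bandwidth_far] excludes for [h n w >= eta] and small [s n]. The null set
    may depend on [eta], since each accuracy calls for a single [eta]. *)
Lemma bandwidth_cvg0 : s n @[n --> \oo] --> 0 ->
  forall eta, 0 < eta -> {ae P, forall w, \forall n \near \oo, h n w < eta}.
Proof.
move=> s0 eta eta0.
have [M M0 HM] := mass_eventually X_iid X_density.
have [e0 e00 Hfar] := large_bandwidth_far K_density eta0 M0.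
move: HM h_solution; apply: filterS2 => w Hw Sw; near=> n.
have n0 : (0 < n)%N by near: n; exact: nbhs_infty_gt.
rewrite ltNge; apply/negP => hn.
apply: (Hfar n (X ^~ w) (h n w) (s n) n0 hn (s_gt0 n0)).
- apply: (le_trans (ler_norm _)); near: n; move/cvgr0Pnorm_le: s0; exact.
- by near: n; exact: Hw.
- move=> a b ab; rewrite -lee_fin EFinM.
  have <- : d (empirical_df n (X ^~ w)) (kernel_df K n (h n w) (X ^~ w)) = (s n)%:E by near: n; exact: Sw.
  exact: d_like.2.
Unshelve. all: by end_near. Qed.

(** [ln (ln n) >= 1] as soon as [n >= expR (expR 1)], so the given rate dominates [sqrt (1 / n)]. *)
Lemma sqrt_le_threshold (e : R) : 0 < e ->
  (fun n : nat => Num.sqrt (ln (ln n%:R) / n%:R) : R^o) =o_\oo (fun n => s n : R^o) ->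
  \forall n \near \oo, Num.sqrt n%:R <= e * (n%:R * s n).
Proof.
move=> e0 /eqoP/(_ e e0) H; near=> n.
have n0 : (0 < n)%N by near: n; exact: nbhs_infty_gt.
have n0' : 0 < n%:R :> R by rewrite ltr0n.
have hn : `|Num.sqrt (ln (ln n%:R) / n%:R)| <= e * `|s n| by near: n; exact: H.
have lln : 1 <= ln (ln n%:R) :> R.
  have big : expR (expR 1) <= n%:R :> R by near: n; exact: nbhs_infty_ger.
  rewrite -[leLHS](expRK 1) ler_ln ?posrE ?expR_gt0//.
    by rewrite -[leLHS](expRK (expR 1)) ler_ln ?posrE ?expR_gt0.
  by rewrite ln_gt0// (lt_le_trans _ big)// -expR0 ltr_expR expR_gt0.
move: hn; rewrite (gtr0_norm (s_gt0 n0)) ger0_norm ?sqrtr_ge0// => hn.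
have h2 : Num.sqrt (n%:R^-1) <= e * s n.
  apply: le_trans hn; apply: ler_wsqrtr; rewrite -[leLHS]mul1r ler_wpM2r// invr_ge0 ltW//.
rewrite (_ : Num.sqrt n%:R = n%:R * Num.sqrt (n%:R^-1)).
  by rewrite mulrCA ler_wpM2l// ltW.
by rewrite sqrtrV ?ltW// -[X in X / _]sqr_sqrtr ?ltW// expr2 mulfK// gt_eqF// sqrtr_gt0.
Unshelve. all: by end_near. Qed.

Lemma bandwidth_lower (al C A : R) : 0 < al -> 0 < C -> 0 < A ->
  (forall x y, `|distribution_function (X 0%N) x - distribution_function (X 0%N) y| <=
    C * `|x - y| `^ al) ->
  (fun n : nat => Num.sqrt (ln (ln n%:R) / n%:R) : R^o) =o_\oo (fun n => s n : R^o) ->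
  n%:R `^ al * s n @[n --> \oo] --> +oo ->
  {ae P, forall w, \forall n \near \oo, A / n%:R < h n w}.
Proof.
move=> al0 C0 A0 hF s_lo s_up.
have [mK K0 K1] := K_density.
(* Order at least 1 makes the first moment of [K] absolutely convergent. *)
have [aK aK0 aKE] : exists2 aK, 0 <= aK & (\int[mu]_y (`|y| * K y)%:E = aK%:E)%E.
  have [l1 Ki _ _ _] := K_kernel.
  have := Ki 1%N l1 => /integrable_abse/integral_fune_fin_num.
  rewrite (_ : (\int[mu]_y _)%E = \int[mu]_y (`|y| * K y)%:E)%E; last first.
    by apply: eq_integral => y _; rewrite /= expr1 normrM (ger0_norm (K0 y)).
  move=> fin; exists (fine (\int[mu]_y (`|y| * K y)%:E)); last by rewrite fineK//; exact: fin.
  by apply: fine_ge0; apply: integral_ge0 => y _; rewrite lee_fin mulr_ge0.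
pose CK := 2 * aK + 2.
have CK0 : 0 < CK by rewrite /CK; lra.
have k0 : 0 < k%:R :> R by rewrite ltr0n.
(* If [h n w <= A / n], the two distribution functions differ by at most [e CK s n = s n / (4 k)],
   so their distance is at most [s n / 2] and cannot equal [s n]. *)
pose e := (4 * k%:R * CK)^-1.
have e0 : 0 < e by rewrite invr_gt0 !mulr_gt0.
pose B := 2 * C * (2 * A) `^ al.
have B0 : 0 < B by rewrite !mulr_gt0// powR_gt0 ?mulr_gt0.
pose kap n (y : R) := Num.truncn (`|y| / (A / n%:R)).
have mkap n j : measurable (kap n @^-1` [set j]) by exact: measurable_abs_cell.
have pk n j : (0 < n)%N ->
    fine (distribution P (X 0%N) (kap n @^-1` [set j])) <= B * n%:R `^ (- al).
  move=> n0; have n0' : 0 < n%:R :> R by rewrite ltr0n.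
  apply: (le_trans (abs_cell_prob j C0 al0 (divr_gt0 A0 n0') hF)).
  rewrite (_ : n%:R `^ (- al) = n%:R^-1 `^ al); last by rewrite -mulN1r powRrM powR_inv1 ?ltW.
  have A2 : 0 <= 2 * A by rewrite mulr_ge0// ltW.
  have ni : 0 <= n%:R^-1 :> R by rewrite invr_ge0.
  by rewrite mulrA powRM// /B mulrA.
have e4 : 0 < e / 4 by rewrite divr_gt0.
have := occupancy_eventually X_iid B0 e0 mkap pk s_up (sqrt_le_threshold e4 s_lo).
move: h_solution; apply: filterS2 => w Sw Ow; near=> n.
have n0 : (0 < n)%N by near: n; exact: nbhs_infty_gt.
have n0' : 0 < n%:R :> R by rewrite ltr0n.
have sn0 := s_gt0 n0.
have dn : d (empirical_df n (X ^~ w)) (kernel_df K n (h n w) (X ^~ w)) = (s n)%:E by near: n; exact: Sw.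
have occ j : \sum_(i < n) (Num.truncn (`|X i w| / (A / n%:R)) == j)%:R <= e * (n%:R * s n).
  rewrite -natr_sum.
  have : forall j, (occupancy X (kap n) n w j)%:R <= e * (n%:R * s n) by near: n; exact: Ow.
  exact.
rewrite ltNge; apply/negP => hn.
have M0 : 0 <= e * (n%:R * s n) by rewrite !mulr_ge0 ?ltW.
have near_F t := kernel_df_near (x := X ^~ w) K_density t aKE n0 (h_gt0 w n0) hn M0 occ.
have := d_like.1 _ _ _ near_F.
rewrite dn lee_fin; apply/negP; rewrite -ltNge.
rewrite [ltLHS](_ : _ = s n / 2); first by rewrite ltr_pdivrMr// ltr_pMr// ltr1n.
by rewrite /e -/CK; field; rewrite !gt_eqF.
Unshelve. all: by end_near. Qed.

End bandwidth_limits.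

(** * Consistency *)

Section consistency.
Context {disp : measure_display} {T : measurableType disp} {R : realType} (P : probability T R).
Local Notation mu := (@lebesgue_measure R).
Variables (K f : R -> R) (K_density : probability_density K).
Variables (X : nat -> {RV P >-> R}) (X_iid : iid X) (X_density : has_density (X 0%N) f).

(** The successor gives the strict inequality that [grid_cell_out] asks for. *)
Definition grid_size (B A : R) (n : nat) : nat := (Num.truncn (2 * B / (A / n%:R))).+1.

Definition sample_grid (B A : R) (n : nat) : R -> 'I_(grid_size B A n).+1 :=
  grid_cell (grid_size B A n) B (A / n%:R).

Lemma histogram_eventually (e : R) : 0 < e -> e <= 4 -> exists A B : R, [/\ 0 < A, 0 < B,
  {ae P, forall w, \forall n \near \oo,
    freq_dev (cell_prob X (sample_grid B A n)) (sample_cells X (sample_grid B A n) n w) <= e} &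
  forall n, (0 < n)%N -> cell_prob X (sample_grid B A n) ord_max <= e].
Proof.
move=> e0 e4; have [N HN] := has_density_tail X_density e0.
have B0 : (0 : R) < N.+1%:R by [].
set B : R := N.+1%:R in HN B0.
(* This [A] makes [2 B n / A] equal to [n e^2 / 64], the growth that [freq_dev_eventually] allows;
   the two extra cells come from rounding up and from the complement of the grid. *)
have A0 : 0 < 128 * B / e ^+ 2 by rewrite divr_gt0 ?mulr_gt0// exprn_gt0.
set A := 128 * B / e ^+ 2 in A0.
exists A, B; split => //.
  apply: (@freq_dev_eventually _ T R P X X_iid (grid_size B A) (sample_grid B A) e 2) => //.
    by move=> n j; exact: measurable_grid_cell.
  near=> n.
  have n0 : (0 < n)%N by near: n; exact: nbhs_infty_gt.
  have n0' : 0 < n%:R :> R by rewrite ltr0n.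
  have E : 2 * B / (A / n%:R) = n%:R * e ^+ 2 / 64.
    by rewrite /A; field; rewrite !gt_eqF.
  have S2 j : j.+2%:R = j%:R + 2 :> R by rewrite -addn2 natrD.
  rewrite /grid_size E S2.
  have : (Num.truncn (n%:R * e ^+ 2 / 64))%:R <= n%:R * e ^+ 2 / 64.
    by rewrite truncn_le divr_ge0// mulr_ge0// sqr_ge0.
  lra.
move=> n n0; have n0' : 0 < n%:R :> R by rewrite ltr0n.
have del0 : 0 < A / n%:R by rewrite divr_gt0.
apply: le_trans HN; rewrite /cell_prob; apply: fine_le; rewrite ?fin_num_measure//.
- exact: measurable_grid_cell.
- exact: measurable_abs_ge.
apply: le_measure; [by rewrite inE; exact: measurable_grid_cell|by rewrite inE; exact: measurable_abs_ge|].
move=> y /= yc; apply: (grid_cell_out del0 _ yc).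
exact: truncnS_gt.
Unshelve. all: by end_near. Qed.

(** Crude bound for points outside the grid, whose distance to the reference point is not
    controlled. *)
Lemma translate_L1_le2 (k : R -> R) (a b : R) : probability_density k ->
  (\int[mu]_t `|k (t - a) - k (t - b)|%:E <= 2%:E)%E.
Proof.
move=> kd; have [mk k0 k1] := kd.
have mks (s : R) : measurable_fun setT (fun t : R => k (t - s)).
  by apply: measurableT_comp => //; exact: measurable_funB.
apply: (@le_trans _ _ (\int[mu]_t ((k (t - a))%:E + (k (t - b))%:E))%E).
  apply: ge0_le_integral => //.
  - by apply/measurable_EFinP; apply: measurableT_comp => //; apply: measurable_funB; exact: mks.
  - by apply: emeasurable_funD; apply/measurable_EFinP; exact: mks.
  by move=> t _; rewrite -EFinD lee_fin (le_trans (ler_normB _ _))// !ger0_norm.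
rewrite ge0_integralD//; last 4 first.
- by move=> t _; rewrite lee_fin.
- by apply/measurable_EFinP; exact: mks.
- by move=> t _; rewrite lee_fin.
- by apply/measurable_EFinP; exact: mks.
by rewrite !integral_density_shift// -EFinD.
Qed.

Lemma sum_freq (I : finType) n (w : {ffun 'I_n -> I}) : (0 < n)%N -> \sum_j freq w j = 1 :> R.
Proof.
move=> n0; rewrite /freq -mulr_sumr exchange_big/=.
rewrite (eq_bigr (fun=> 1)); last first.
  move=> i _; rewrite (bigD1 (w i))//= eqxx big1 ?addr0// => j.
  by rewrite eq_sym => /negbTE ->.
by rewrite sumr_const card_ord mulVf// pnatr_eq0 -lt0n.
Qed.

(** Deterministic in [w] and [h], which admits a data-dependent bandwidth. The condition
    [A / n <= dK * h] says that a displacement inside a cell is at most [dK] after rescaling. *)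
Lemma kde_L1_on_histogram (e A B dK h : R) n w : 0 < e -> 0 < A -> 0 < h -> (0 < n)%N ->
  (forall t, `|t| <= dK -> (\int[mu]_x `|K (x + t)%R - K x|%:E <= e%:E)%E) ->
  A / n%:R <= dK * h ->
  (\int[mu]_t (\int[mu]_y (`|f t - f y| * rescale K h (t - y))%:E) <= e%:E)%E ->
  freq_dev (cell_prob X (sample_grid B A n)) (sample_cells X (sample_grid B A n) n w) <= e ->
  cell_prob X (sample_grid B A n) ord_max <= e ->
  (\int[mu]_x `|kde K n h (X ^~ w) x - f x|%:E <= (10 * e)%:E)%E.
Proof.
move=> e0 A0 h0 n0 HdK Ah Rh Vn pmax.
have n0' : 0 < n%:R :> R by rewrite ltr0n.
have del0 : 0 < A / n%:R by rewrite divr_gt0.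
have [fd fX] := X_density; have [mK K0 K1] := K_density.
have kd := rescale_density h0 K_density.
pose c := sample_grid B A n.
have mc j : measurable (c @^-1` [set j]) by exact: measurable_grid_cell.
pose r := @grid_point R (grid_size B A n) B (A / n%:R).
pose p := cell_prob X c.
pose m j : R := freq (sample_cells X c n w) j.
pose g (j : 'I_(grid_size B A n).+1) : R := e + 2 * (j == ord_max)%:R.
have pE j : (\int[mu]_(y in c @^-1` [set j]) (f y)%:E = (p j)%:E)%E.
  by rewrite -fX// /p cell_probE.
have mE j : m j = n%:R^-1 * \sum_(i < n) (c (X i w) == j)%:R by exact: sample_freqE.
have g0 j : 0 <= g j by rewrite /g addr_ge0 ?mulr_ge0// ltW.
have gE y : (\int[mu]_t `|rescale K h (t - r (c y)) - rescale K h (t - y)|%:E <= (g (c y))%:E)%E.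
  rewrite /g; have [cy|cy] := eqVneq (c y) ord_max.
    apply: (le_trans (translate_L1_le2 _ _ kd)); rewrite lee_fin mulr1; lra.
  rewrite rescale_translation// mulr0 addr0; apply: HdK.
  rewrite normrM normfV (gtr0_norm h0) ler_pdivrMr//; apply: le_trans Ah.
  apply: grid_cell_in => //.
  by rewrite ltW//; exact: truncnS_gt.
under eq_integral do rewrite kde_rescale.
have := @kde_L1_bound R (rescale K h) f kd fd _ c r mc p pE n (X ^~ w) m g e%:E n0 mE gE Rh g0.
move=> /le_trans; apply; rewrite -EFinD lee_fin.
have sum_g (q : 'I_(grid_size B A n).+1 -> R) : \sum_j q j * g j = e * \sum_j q j + 2 * q ord_max.
  rewrite /g; under eq_bigr do rewrite mulrDr.
  rewrite big_split/= -mulr_suml mulrC; congr (_ + _).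
  rewrite (bigD1 ord_max)//= eqxx big1 ?addr0; first by rewrite mulr1 mulrC.
  by move=> j /negbTE ->; rewrite !mulr0.
have m1 : \sum_j m j = 1 by exact: sum_freq.
have p1 : \sum_j p j = 1 by exact: sum_cell_prob.
have mmax : `|m ord_max - p ord_max| <= e.
  by apply: le_trans Vn; rewrite /freq_dev (bigD1 ord_max)//= lerDl sumr_ge0.
(* The outer cell has frequency at most [p ord_max + e <= 2 e], so the total is
   [(e + 4 e) + e + (e + 2 e) + e = 10 e]. *)
rewrite !sum_g m1 p1.
have V' : \sum_j `|m j - p j| <= e by exact: Vn.
have p' : p ord_max <= e by exact: pmax.
by move: mmax; rewrite ler_norml => /andP[_]; lra.
Qed.

End consistency.

Theorem corollary2p1 (R : realType)
    (disp : measure_display) (T : measurableType disp) (P : probability T R)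
    (l : nat) (K : R -> R)
    (K_kernel : kernel_of_order l K) (K_density : probability_density K)
    (X : nat -> {RV P >-> R}) (X_iid : iid X)
    (f : R -> R) (X_density : has_density (X 0%N) f)
    (alpha : R) (alpha_gt0 : 0 < alpha) (alpha_le1 : alpha <= 1)
    (F_holder : holder_class alpha (distribution_function (X 0%N)))
    (d : (R -> R) -> (R -> R) -> \bar R)
    (d_choice : d = @d_infty R \/ exists2 k : nat, (1 <= k)%N & d = @d_kuip R k)
    (s : nat -> R) (s_gt0 : forall n, (1 <= n)%N -> 0 < s n)
    (s_cvg0 : s n @[n --> \oo] --> 0)
    (s_lower : (fun n : nat => Num.sqrt (ln (ln n%:R) / n%:R) : R^o)
                 =o_\oo (fun n => s n : R^o))
    (s_upper : n%:R `^ alpha * s n @[n --> \oo] --> +oo)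
    (h : nat -> {RV P >-> R})
    (h_gt0 : forall n w, (1 <= n)%N -> 0 < h n w)
    (h_solution : {ae P, forall w, \forall n \near \oo,
        d (empirical_df n (X ^~ w)) (kernel_df K n (h n w) (X ^~ w))
          = (s n)%:E}) :
  {ae P, forall w,
    (\int[@lebesgue_measure R]_x `|kde K n (h n w) (X ^~ w) x - f x|%:E)%E
      @[n --> \oo] --> 0%E}.
Proof.
have [k k1 d_like] : exists2 k, (1 <= k)%N & distance_like k d.
  case: d_choice => [->|[k k1 ->]]; first by exists 1%N => //; exact: d_infty_like.
  by exists k => //; exact: d_kuip_like.
have [C C0 hF] := F_holder.
have fd := X_density.1.
pose err n w : \bar R := (\int[@lebesgue_measure R]_x `|kde K n (h n w) (X ^~ w) x - f x|%:E)%E.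
have small (e : R) : 0 < e -> e <= 4 ->
    {ae P, forall w, \forall n \near \oo, (err n w <= (10 * e)%:E)%E}.
  move=> e0 e4.
  have [A [B [A0 B0 Hdev Hmax]]] := histogram_eventually X_iid X_density e0 e4.
  have [dK dK0 HdK] := L1_translation (density_integrable K_density) e0.
  have [eta eta0 Heta] := approximate_identity K_density fd e0.
  have h_up := bandwidth_cvg0 K_density X_iid X_density d_like s_gt0 h_solution s_cvg0 eta0.
  (* The lower bound holds for any constant; [A / dK] is the one that yields
     [A / n <= dK * h n w]. *)
  have h_lo := bandwidth_lower K_kernel K_density X_iid d_like k1 s_gt0 h_gt0 h_solution
    alpha_gt0 C0 (divr_gt0 A0 dK0) hF s_lower s_upper.
  move: Hdev h_up h_lo; apply: filterS3 => w Hw Uw Lw; near=> n.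
  have n0 : (0 < n)%N by near: n; exact: nbhs_infty_gt.
  have hn0 := h_gt0 n w n0.
  apply: (kde_L1_on_histogram (e := e) (A := A) (B := B) (dK := dK) K_density X_density) => //.
  - have : A / dK / n%:R < h n w by near: n; exact: Lw.
    by move=> /ltW Ah; rewrite -ler_pdivrMl// mulrC mulrAC.
  - by apply: Heta => //; rewrite ltW//; near: n; exact: Uw.
  - by near: n; exact: Hw.
  - exact: Hmax.
have e_ok (i : nat) : 0 < (i.+1%:R^-1 : R) /\ (i.+1%:R^-1 : R) <= 4.
  split; first by rewrite invr_gt0.
  by apply: (@le_trans _ _ 1); rewrite ?invf_le1 ?ltr0n// ler1n.
(* The null sets depend on the accuracy, so countably many accuracies [1 / (i + 1)] are taken
   together. *)
have := ae_foralln (fun i => small _ (e_ok i).1 (e_ok i).2).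
apply: filterS => w Hw.
have err0 n : (0 <= err n w)%E by apply: integral_ge0 => x _; rewrite lee_fin.
apply/fine_cvgP; split.
  near=> n; rewrite (ge0_fin_numE (err0 n)).
  have : (err n w <= (10 * 1%:R^-1)%:E)%E by near: n; exact: (Hw 0%N).
  by move=> /le_lt_trans; apply; exact: ltry.
apply/cvgr0Pnorm_le => e e0.
pose i := Num.truncn (10 / e).
have ie : 10 * i.+1%:R^-1 <= e.
  by rewrite ler_pdivrMr// -ler_pdivrMl// mulrC ltW//; exact: truncnS_gt.
near=> n => /=.
have le_e : (err n w <= (10 * i.+1%:R^-1)%:E)%E by near: n; exact: (Hw i).
have fin : err n w \is a fin_num by rewrite (ge0_fin_numE (err0 n)) (le_lt_trans le_e)// ltry.
rewrite ger0_norm; last by rewrite fine_ge0// err0.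
by apply: le_trans ie; rewrite -lee_fin fineK.
Unshelve. all: by end_near. Qed.
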